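(* There exists an algorithm which, given a semi-complete digraph $T$ and integers $k$ and $\ell\ge 5k$, in time $O(k|V(T)|^2)$ outputs one of the following: (1) an $(\ell+2,k)$-degree tangle in $T$; (2) a $(k+1,k)$-matching tangle in $T$; (3) a path decomposition of $T$ of width at most $\ell+2k$. In the first two cases $\mathbf{pw}(T)>k$.
   Context: All digraphs are simple. A digraph $T$ is semi-complete if for every two distinct vertices $v,w$ at least one of the arcs $(v,w)$, $(w,v)$ is present. $d^+(v)$ is the outdegree of $v$. A path decomposition of a digraph $G=(V,E)$ is a sequence $(W_1,\dots,W_r)$ of subsets of $V$ such that (i) $\bigcup_i W_i=V$; (ii) $W_i\cap W_k\subseteq W_j$ for $1\le i<j<k\le r$; (iii) for every arc $(u,v)\in E$, either $u,v\in W_i$ for some $i$, or $u\in W_i$, $v\in W_j$ for some $i>j$. Its width is $\max_i(|W_i|-1)$, and $\mathbf{pw}(G)$ is the minimum width of a path decomposition of $G$. For integers $k,\ell$: a $(k,\ell)$-degree tangle is a set $X\subseteq V(T)$ with $|X|\ge k$ and $|d^+(v)-d^+(w)|\le\ell$ for all $v,w\in X$; a $(k,\ell)$-matching tangle is a pair of disjoint sets $X,Y\subseteq V(T)$ with $|X|=|Y|=k$, such that there is a bijection $f:X\to Y$ with $(v,f(v))\in E(T)$ for all $v\in X$, and $d^+(w)>d^+(v)+\ell$ for all $v\in X$, $w\in Y$. *)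

(* Defs.v *)
From HB Require Import structures.
From mathcomp Require Import all_boot all_order all_algebra.
From mathcomp Require Import boolp.

Set Implicit Arguments.
Unset Strict Implicit.
Unset Printing Implicit Defensive.

Import Order.TTheory GRing.Theory Num.Theory.

Local Open Scope nat_scope.

Section Digraph.

(* A digraph is its arc relation.  Antiparallel arcs are allowed; loops are
   excluded by an irreflexivity hypothesis wherever "simple" is required. *)
Variables (V : finType) (E : rel V).

Definition semicomplete : Prop := forall v w : V, v != w -> E v w || E w v.

Definition outdeg (v : V) : nat := #|[set w | E v w]|.

Definition path_decomposition (s : seq {set V}) : Prop :=
  [/\ \bigcup_(W <- s) W = [set: V],
      forall i j k, i < j -> j < k -> k < size s ->
        nth set0 s i :&: nth set0 s k \subset nth set0 s j
    & forall u v, E u v ->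
        (exists i, [/\ i < size s, u \in nth set0 s i & v \in nth set0 s i])
        \/ (exists i j, [/\ j < i, i < size s,
                            u \in nth set0 s i & v \in nth set0 s j])].

(* Integer-valued because the empty digraph has width -1. *)
Definition width (s : seq {set V}) : int :=
  ((\max_(W <- s) #|W|)%:Z - 1)%R.

Lemma path_decomposition_setT : path_decomposition [:: [set: V]].
Proof.
split; first by rewrite big_seq1.
  by move=> i [//|j] [//|k].
by move=> u v _; left; exists 0; rewrite !inE.
Qed.

Lemma ex_width : exists m : nat,
  `[< exists2 s, path_decomposition s & width s = (m%:Z - 1)%R >].
Proof.
exists #|V|; apply/asboolP; exists [:: [set: V]].
  exact: path_decomposition_setT.
by rewrite /width big_seq1 cardsT.
Qed.

(* Every width is of the form m - 1 with m a natural number, so the minimum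
   is taken over m. *)
Definition pw : int := ((ex_minn ex_width)%:Z - 1)%R.

Definition degree_tangle (k l : nat) (X : {set V}) : Prop :=
  k <= #|X| /\
  forall v w, v \in X -> w \in X -> (`|(outdeg v)%:Z - (outdeg w)%:Z| <= l%:Z)%R.

Definition matching_tangle (k l : nat) (X Y : {set V}) : Prop :=
  [/\ [disjoint X & Y], #|X| = k, #|Y| = k,
      exists f : V -> V, [/\ {in X &, injective f}, f @: X = Y
                           & forall v, v \in X -> E v (f v)]
    & forall v w, v \in X -> w \in Y -> outdeg v + l < outdeg w].

End Digraph.

(* Algorithms are programs for a unit-cost random-access machine with bounded
   words, presented as a structured language.  The memory is a family of
   arrays of natural numbers; a program only names finitely many of them, and
   a scalar variable is cell 0 of an array.  There is no multiplication, and
   subtraction is truncated. *)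
Definition memory : Type := nat -> nat -> nat.

Definition update (m : memory) (a i x : nat) : memory :=
  fun b j => if (b == a) && (j == i) then x else m b j.

Inductive expr : Type :=
| Const of nat
| Cell of nat & expr
| Plus of expr & expr
| Minus of expr & expr.

Fixpoint eval (m : memory) (e : expr) : nat :=
  match e with
  | Const x => x
  | Cell a i => m a (eval m i)
  | Plus e1 e2 => eval m e1 + eval m e2
  | Minus e1 e2 => eval m e1 - eval m e2
  end.

(* [Assign a i e] is a[i] := e; [Emit e] appends e to a write-only output
   tape; a test succeeds when its value is nonzero. *)
Inductive cmd : Type :=
| Skip
| Assign of nat & expr & expr
| Emit of expr
| Seq of cmd & cmd
| If of expr & cmd & cmd
| While of expr & cmd.

(* [exec B c m o t m' o'] : started with memory m and output o, the program c
   halts after t steps with memory m' and output o', and never stores or emits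
   a value above B (such a store has no transition).  Elementary commands and
   tests take one step: the expressions of a program have constant size, so
   this is the number of elementary operations up to a constant factor. *)
Inductive exec (B : nat) :
  cmd -> memory -> seq nat -> nat -> memory -> seq nat -> Prop :=
| ExecSkip m o : exec B Skip m o 1 m o
| ExecAssign a i e m o : eval m e <= B ->
    exec B (Assign a i e) m o 1 (update m a (eval m i) (eval m e)) o
| ExecEmit e m o : eval m e <= B ->
    exec B (Emit e) m o 1 m (rcons o (eval m e))
| ExecSeq c1 c2 m o t1 m1 o1 t2 m2 o2 :
    exec B c1 m o t1 m1 o1 -> exec B c2 m1 o1 t2 m2 o2 ->
    exec B (Seq c1 c2) m o (t1 + t2) m2 o2
| ExecIfTrue e c1 c2 m o t m1 o1 : eval m e != 0 ->
    exec B c1 m o t m1 o1 -> exec B (If e c1 c2) m o t.+1 m1 o1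
| ExecIfFalse e c1 c2 m o t m1 o1 : eval m e = 0 ->
    exec B c2 m o t m1 o1 -> exec B (If e c1 c2) m o t.+1 m1 o1
| ExecWhileTrue e c m o t1 m1 o1 t2 m2 o2 : eval m e != 0 ->
    exec B c m o t1 m1 o1 -> exec B (While e c) m1 o1 t2 m2 o2 ->
    exec B (While e c) m o (t1 + t2).+1 m2 o2
| ExecWhileFalse e c m o : eval m e = 0 ->
    exec B (While e c) m o 1 m o.

(* Array 0 holds n, k, l and array 1 the adjacency matrix in row-major order;
   all other cells are 0. *)
Definition input (n : nat) (E : rel 'I_n) (k l : nat) : memory :=
  fun a i =>
    match a with
    | 0 => nth 0 [:: n; k; l] i
    | 1 => nth 0 [seq nat_of_bool (E u v) | u <- enum 'I_n, v <- enum 'I_n] i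
    | _ => 0
    end.

(* A set of vertices is output as its characteristic vector (n bits), and a
   list of sets as the concatenation of these vectors; a leading tag tells
   which kind of object follows. *)
Definition encode (n tag : nat) (s : seq {set 'I_n}) : seq nat :=
  tag :: flatten
    [seq [seq nat_of_bool (v \in W) | v <- enum 'I_n] | W : {set 'I_n} <- s].

(* Main.v *)
(* Order the vertices by outdegree and let [rank v] be the position of [v].  If
   some window of [l + 2] consecutive vertices has outdegrees within [k], it is a
   degree tangle.  Otherwise, for each j, consider the bipartite graph of arcs
   from X = {rank < j} to Y = {rank >= j + l}: any matching of size [k + 1] in it
   is a matching tangle.  The sweep over j maintains a matching of size at most
   [k] together with a set S of vertices of X, such that every unmatched vertex of
   X lies in S and every out-neighbour of S in Y is labelled and matched.  Then
   the vertices outside S and outside the unlabelled part of Y are the middle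
   window, matched vertices of X and matched vertices of Y.  S and the labels only
   grow, so these sets are the bags of a path decomposition, in which a vertex
   occurs from the step at which it leaves the unlabelled part of Y up to the step
   at which it joins S.  When a vertex x outside S is unmatched, because it has
   just joined X or because its mate has just left Y, one alternating search from
   x suffices: it either augments the matching or adds all the vertices it reaches
   to S or to the labelled ones.  It expands x and matched vertices only, at most
   [k + 1] in all, hence the bound O(k n) per search.

   For the lower bounds on the width, represent a decomposition by the intervals
   [fi v, la v].  Up to an error of [k], the outdegree of [v] is at most the number
   of intervals that end before [la v], and it is at least the number of those
   that end before [fi v].  *)

Require Import Defs.
From mathcomp Require Import all_boot all_order all_algebra.
From mathcomp Require Import boolp zify.

Set Implicit Arguments.
Unset Strict Implicit.
Unset Printing Implicit Defensive.

Local Open Scope nat_scope.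

Section Intervals.

Variables (V : finType) (E : rel V).

Definition interval_model (fi la : V -> nat) : Prop :=
  (forall v, fi v <= la v) /\ (forall u v, E u v -> fi v <= la u).

Definition bag (fi la : V -> nat) (i : nat) : {set V} :=
  [set v | fi v <= i <= la v].

Lemma path_decomposition_intervals (s : seq {set V}) :
  path_decomposition E s ->
  exists fi la : V -> nat,
    interval_model fi la /\ forall i, bag fi la i \subset nth set0 s i.
Proof.
case=> cover conv arcs.
have mem v : exists i, (i < size s) && (v \in nth set0 s i).
  have : v \in \bigcup_(W <- s) W by rewrite cover inE.
  rewrite (big_nth set0) big_mkord => /bigcupP [i _ vi].
  by exists i; rewrite ltn_ord.
have memlt v i : (i < size s) && (v \in nth set0 s i) -> i <= size s.
  by case/andP => /ltnW.
pose fi v := ex_minn (mem v).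
pose la v := ex_maxn (mem v) (@memlt v).
have fiP v : fi v < size s /\ v \in nth set0 s (fi v).
  by rewrite /fi; case: ex_minnP => i /andP[].
have laP v : la v < size s /\ v \in nth set0 s (la v).
  by rewrite /la; case: ex_maxnP => i /andP[].
have fi_min v i : i < size s -> v \in nth set0 s i -> fi v <= i.
  by move=> si vi; rewrite /fi; case: ex_minnP => j _; apply; rewrite si.
have la_max v i : i < size s -> v \in nth set0 s i -> i <= la v.
  by move=> si vi; rewrite /la; case: ex_maxnP => j _; apply; rewrite si.
have fila v : fi v <= la v by have [a b] := laP v; exact: fi_min.
exists fi, la; split; [split=> // u v /arcs | move=> i].
  case=> [[i [si ui vi]]|[i [j [ji si ui vj]]]].
    exact: leq_trans (fi_min _ _ si vi) (la_max _ _ si ui).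
  have := fi_min _ _ (ltn_trans ji si) vj; have := la_max _ _ si ui; lia.
apply/subsetP=> v; rewrite inE => /andP[].
have [lt_la v_la] := laP v; have [_ v_fi] := fiP v.
rewrite leq_eqVlt => /orP[/eqP <- // | fi_i].
rewrite leq_eqVlt => /orP[/eqP -> // | i_la].
apply: (subsetP (conv _ _ _ fi_i i_la lt_la)).
by rewrite inE v_fi v_la.
Qed.

Lemma path_decomposition_bags (fi la : V -> nat) r :
  interval_model fi la -> (forall v, fi v < r) ->
  path_decomposition E (mkseq (bag fi la) r).
Proof.
case=> fila arcs fir; split.
- apply/setP=> v; rewrite inE; apply/idP.
  rewrite big_map (big_nth 0) size_iota big_mkord.
  apply/bigcupP; exists (Ordinal (fir v)) => //=.
  by rewrite nth_iota // inE leqnn fila.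
- move=> i j k ij jk; rewrite size_mkseq => kr.
  rewrite !nth_mkseq //; try lia.
  by apply/subsetP=> v; rewrite !inE; lia.
- move=> u v /arcs uv; rewrite size_mkseq.
  have [vu|uv'] := leqP (fi u) (fi v).
    left; exists (fi v); rewrite fir !nth_mkseq // !inE leqnn fila; split=> //.
    by rewrite vu.
  right; exists (fi u), (fi v); rewrite uv' fir !nth_mkseq // !inE !leqnn !fila.
  by split.
Qed.

Lemma pw_gt (k : nat) :
  (forall s, path_decomposition E s -> exists i, k.+1 < #|nth set0 s i|) ->
  (k%:Z < pw E)%R.
Proof.
move=> big; rewrite /pw; case: ex_minnP => m /asboolP[s sP sm] _.
have [i ki] := big _ sP.
have : #|nth set0 s i| <= \max_(W <- s) #|W|.
  have [si|si] := ltnP i (size s); last by rewrite nth_default // cards0.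
  by apply: (@leq_bigmax_seq _ _ xpredT (fun W : {set V} => #|W|)) => //; exact: mem_nth.
move: sm; rewrite /width; lia.
Qed.

Section Lower.
Variables (fi la : V -> nat) (k : nat).
Hypothesis irrE : irreflexive E.
Hypothesis scE : semicomplete E.
Hypothesis model : interval_model fi la.
Hypothesis small : forall i, #|bag fi la i| <= k.+1.

Lemma outdeg_ge v : #|[set u | la u < fi v]| <= outdeg E v.
Proof.
apply/subset_leq_card/subsetP=> u; rewrite !inE => uv.
have /scE/orP[] // : v != u.
  by apply/eqP=> vu; have := model.1 v; move: uv; rewrite vu; lia.
by move/model.2; lia.
Qed.

Lemma outdeg_le v : outdeg E v <= #|[set u | la u < la v]| + k.
Proof.
have v_in : v \in bag fi la (la v) by rewrite inE leqnn model.1.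
have : outdeg E v <= #|[set u | la u < la v] :|: (bag fi la (la v) :\ v)|.
  apply/subset_leq_card/subsetP=> u; rewrite !inE => vu.
  have -> : u != v by apply: contraTneq vu => ->; rewrite irrE.
  by rewrite (model.2 _ _ vu); lia.
move/leq_trans; apply; apply: leq_trans (leq_card_setU _ _) _.
rewrite leq_add2l; have := small (la v).
by rewrite (cardsD1 v) v_in.
Qed.

Lemma no_degree_tangle d X : 3 * k + 2 <= d -> ~ degree_tangle E d k X.
Proof.
move=> dk [Xd degX].
have [x0 x0X] : exists x, x \in X by apply/card_gt0P; lia.
pose v := [arg min_(v < x0 in X) la v]; pose w := [arg max_(w > x0 in X) fi w].
have [vX vmin] : v \in X /\ forall u, u \in X -> la v <= la u.
  by rewrite /v; case: arg_minnP.
have [wX wmax] : w \in X /\ forall u, u \in X -> fi u <= fi w.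
  by rewrite /w; case: arg_maxnP.
have := degX _ _ vX wX; have := outdeg_le v; have := outdeg_ge w.
set A := [set u | la u < fi w]; set A' := [set u | la u < la v].
have : #|X| <= #|A :&: X| + k.+1.
  rewrite -(cardsID A X) setIC leq_add2l.
  apply: leq_trans _ (small (fi w)).
  apply/subset_leq_card/subsetP=> u; rewrite !inE -leqNgt => /andP[-> uX].
  by rewrite wmax.
have : fi w <= la v -> #|A :&: X| = 0.
  move=> wv; apply/eqP; rewrite cards_eq0; apply/eqP/setP=> u; rewrite !inE.
  by case uX : (u \in X); rewrite ?andbF // andbT; have := vmin _ uX; lia.
have : la v < fi w -> #|A'| + #|A :&: X| <= #|A|.
  move=> vw; rewrite addnC -(cardsID X A) leq_add2l.
  apply/subset_leq_card/subsetP=> u; rewrite !inE => uv.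
  case uX : (u \in X); first by have := vmin _ uX; lia.
  by rewrite /= (ltn_trans uv).
by case: (leqP (fi w) (la v)) => _; lia.
Qed.

Lemma no_matching_tangle X Y : ~ matching_tangle E k.+1 k X Y.
Proof.
case=> disXY cX cY [f [injf fX arcf]] degXY.
have [x0 x0X] : exists x, x \in X by apply/card_gt0P; lia.
have [y0 y0Y] : exists y, y \in Y by apply/card_gt0P; lia.
pose w := [arg min_(v < y0 in Y) la v]; pose v := [arg max_(w > x0 in X) fi w].
have [wY wmin] : w \in Y /\ forall u, u \in Y -> la w <= la u.
  by rewrite /w; case: arg_minnP.
have [vX vmax] : v \in X /\ forall u, u \in X -> fi u <= fi v.
  by rewrite /v; case: arg_maxnP.
have [z fiz laz] : exists2 z, fi v <= la z & la z < la w.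
  have : ~~ ([set u | la u < la w] \subset [set u | la u < fi v]).
    apply: contraTN (degXY _ _ vX wY) => /subset_leq_card.
    have := outdeg_le w; have := outdeg_ge v; lia.
  by case/subsetPn=> z; rewrite !inE -leqNgt; exists z.
(* From each pair (x, f x), a vertex of the bag of index [la z] that outlives it. *)
pose r x := if la z < la x then x else f x.
have rX x : x \in X -> r x \in X = (la z < la x).
  move=> xX; rewrite /r; case: ifP => // _.
  by apply/negP=> fxX; move/disjointFr: disXY => /(_ _ fxX); rewrite -fX imset_f.
have injr : {in X &, injective r}.
  move=> x x' xX x'X rr; have := rX _ xX; rewrite rr rX // => la_eq.
  by move: rr; rewrite /r la_eq; case: ifP => // _; exact: injf.
have : z |: r @: X \subset bag fi la (la z).
  rewrite subUset sub1set inE leqnn model.1 /=; apply/subsetP=> _ /imsetP[x xX ->].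
  have fx := vmax _ xX; have fxY : f x \in Y by rewrite -fX imset_f.
  have := wmin _ fxY; have := model.2 _ _ (arcf _ xX).
  rewrite inE /r; case: ifP; lia.
move/subset_leq_card; rewrite cardsU1 (card_in_imset injr) cX.
have -> : z \notin r @: X.
  apply/imsetP=> -[x xX zr]; have fxY : f x \in Y by rewrite -fX imset_f.
  have := wmin _ fxY; move: zr; rewrite /r; case: ifP => [zx zE|_ zE].
    by rewrite zE in zx; lia.
  by rewrite -zE; lia.
have := small (la z); lia.
Qed.

End Lower.

Lemma pw_gt_of_models (k : nat) (P : Prop) :
  (forall fi la, interval_model fi la -> (forall i, #|bag fi la i| <= k.+1) -> ~ P) ->
  P -> (k%:Z < pw E)%R.
Proof.
move=> noP HP; apply: pw_gt => s /path_decomposition_intervals[fi [la [mod sub]]].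
apply: contrapT => small; apply: (noP _ _ mod _ HP) => i.
rewrite leqNgt; apply/negP => big; apply: small; exists i.
exact: leq_trans big (subset_leq_card (sub i)).
Qed.

End Intervals.

(** * Execution of programs *)

Notation Var a := (Cell a (Const 0)).
Notation "c1 ;; c2" := (Seq c1 c2) (at level 65, right associativity).

Definition upd (f : nat -> nat) (i x : nat) : nat -> nat :=
  fun j => if j == i then x else f j.

Definition frame (s : seq nat) (m m' : memory) : Prop :=
  forall a, a \notin s -> m' a = m a.

Lemma updateE m a i x b j :
  update m a i x b j = if (b == a) && (j == i) then x else m b j.
Proof. by []. Qed.

Lemma frame_update s m a i x : a \in s -> frame s m (update m a i x).
Proof.
move=> ins b bs; apply/funext => j; rewrite /update.
by case: eqVneq => [ba|] //; rewrite ba ins in bs.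
Qed.

Lemma frame_trans s m m' m'' : frame s m m' -> frame s m' m'' -> frame s m m''.
Proof. by move=> f g a as_; rewrite g // f. Qed.

Lemma frame_sub s s' m m' : all (mem s') s -> frame s m m' -> frame s' m m'.
Proof. by move/allP => ss f a as_; apply: f; apply: contra as_ => /ss. Qed.

Section Runs.
Variable B : nat.

Definition runs (c : cmd) (m : memory) (o : seq nat)
    (Q : nat -> memory -> seq nat -> Prop) : Prop :=
  exists t m' o', exec B c m o t m' o' /\ Q t m' o'.

Lemma runs_weaken c m o (Q Q' : nat -> memory -> seq nat -> Prop) :
  runs c m o Q -> (forall t m' o', Q t m' o' -> Q' t m' o') -> runs c m o Q'.
Proof. by case=> t [m' [o' [ex q]]] QQ; exists t, m', o'; split; last exact: QQ. Qed.

Lemma runs_skip m o (Q : nat -> memory -> seq nat -> Prop) :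
  Q 1 m o -> runs Skip m o Q.
Proof. by move=> q; exists 1, m, o; split=> //; constructor. Qed.

Lemma runs_assign a i e m o (Q : nat -> memory -> seq nat -> Prop) :
  eval m e <= B -> Q 1 (update m a (eval m i) (eval m e)) o ->
  runs (Assign a i e) m o Q.
Proof.
by move=> eB q; exists 1, (update m a (eval m i) (eval m e)), o; split=> //; constructor.
Qed.

Lemma runs_emit e m o (Q : nat -> memory -> seq nat -> Prop) :
  eval m e <= B -> Q 1 m (rcons o (eval m e)) -> runs (Emit e) m o Q.
Proof. by move=> eB q; exists 1, m, (rcons o (eval m e)); split=> //; constructor. Qed.

Lemma runs_seq c1 c2 m o (Q : nat -> memory -> seq nat -> Prop) :
  runs c1 m o (fun t1 m1 o1 => runs c2 m1 o1 (fun t2 => Q (t1 + t2))) ->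
  runs (c1 ;; c2) m o Q.
Proof.
case=> t1 [m1 [o1 [ex1 [t2 [m2 [o2 [ex2 q]]]]]]].
by exists (t1 + t2), m2, o2; split=> //; apply: ExecSeq ex1 ex2.
Qed.

Lemma runs_if e c1 c2 m o (Q : nat -> memory -> seq nat -> Prop) :
  (eval m e != 0 -> runs c1 m o (fun t => Q t.+1)) ->
  (eval m e = 0 -> runs c2 m o (fun t => Q t.+1)) ->
  runs (If e c1 c2) m o Q.
Proof.
move=> r1 r2; have [e0|e1] := eqVneq (eval m e) 0.
  case: (r2 e0) => t [m' [o' [ex q]]].
  by exists t.+1, m', o'; split=> //; apply: ExecIfFalse.
case: (r1 e1) => t [m' [o' [ex q]]].
by exists t.+1, m', o'; split=> //; apply: ExecIfTrue.
Qed.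

(* [I r] is the loop invariant when at most [r] further iterations remain. *)
Lemma runs_while e c T (I : nat -> memory -> seq nat -> Prop) N m o
    (Q : nat -> memory -> seq nat -> Prop) :
  (forall r m o, I r m o -> eval m e != 0 ->
     runs c m o (fun t m' o' => t <= T /\ exists2 r', r' < r & I r' m' o')) ->
  I N m o ->
  (forall t r m' o', t <= N * T.+1 + 1 -> I r m' o' -> eval m' e = 0 -> Q t m' o') ->
  runs (While e c) m o Q.
Proof.
move=> body IN post; suff: runs (While e c) m o (fun t m' o' =>
    t <= N * T.+1 + 1 /\ exists r, I r m' o' /\ eval m' e = 0).
  by move/runs_weaken; apply=> t m' o' [tT [r [Ir e0]]]; exact: post tT Ir e0.
elim/ltn_ind: N m o IN {post} => N IH m o IN.
have [e0|e1] := eqVneq (eval m e) 0.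
  exists 1, m, o; split; first exact: ExecWhileFalse.
  by split; [lia | exists N].
have [t1 [m1 [o1 [ex1 [t1T [r rN Ir]]]]]] := body _ _ _ IN e1.
have [t2 [m2 [o2 [ex2 [t2T fin]]]]] := IH _ rN _ _ Ir.
exists (t1 + t2).+1, m2, o2; split; first exact: ExecWhileTrue ex1 ex2.
split=> //; have : r.+1 * T.+1 <= N * T.+1 by rewrite leq_mul2r rN orbT.
lia.
Qed.

(* Cell 0 of array 0 is the number of vertices. *)
Definition For (a : nat) (c : cmd) : cmd :=
  Assign a (Const 0) (Const 0) ;;
  While (Minus (Var 0) (Var a)) (c ;; Assign a (Const 0) (Plus (Var a) (Const 1))).

Lemma runs_for a c n T (I : nat -> memory -> seq nat -> Prop) m o
    (Q : nat -> memory -> seq nat -> Prop) :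
  0 < a -> n <= B -> m 0 0 = n -> I 0 (update m a 0 0) o ->
  (forall i m o, i < n -> m 0 0 = n -> m a 0 = i -> I i m o ->
     runs c m o (fun t m' o' =>
       [/\ t <= T, m' 0 0 = n, m' a 0 = i & I i.+1 (update m' a 0 i.+1) o'])) ->
  (forall t m' o', t <= n * T.+2 + 2 -> m' 0 0 = n -> m' a 0 = n -> I n m' o' ->
     Q t m' o') ->
  runs (For a c) m o Q.
Proof.
move=> a_gt0 nB m00 I0 body post.
have a0 x m1 : update m1 a 0 x 0 0 = m1 0 0 by rewrite /update; case: a a_gt0 {I0 body post}.
have aa x m1 : update m1 a 0 x a 0 = x by rewrite /update !eqxx.
apply: runs_seq; apply: runs_assign => //=.
pose J r m o := [/\ m 0 0 = n, m a 0 <= n, r = n - m a 0 & I (m a 0) m o].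
apply: (@runs_while _ _ T.+1 J n).
- move=> r m1 o1 [m100 le_n rE Im1] /= lt_n.
  have {}lt_n : m1 a 0 < n by rewrite m100 in lt_n; lia.
  apply: runs_seq; apply: runs_weaken (body _ _ _ lt_n m100 erefl Im1) _.
  move=> t m2 o2 [tT m200 m2a I2]; apply: runs_assign => /=; first by rewrite m2a; lia.
  split; first lia.
  exists (n - (m1 a 0).+1); first lia.
  split; rewrite ?a0 ?aa ?m2a ?addn1 //.
- by split; rewrite ?a0 ?aa ?subn0.
- move=> t r m1 o1 tT [m100 le_n _ Im] /=; rewrite m100 => n_le.
  have E : m1 a 0 = n by lia.
  by apply: post => //; [lia | rewrite -{1}E].
Qed.

End Runs.

(** * Alternating search and the state of the sweep *)

Lemma updE f i x j : upd f i x j = if j == i then x else f j.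
Proof. by []. Qed.

Section Support.
Variable n : nat.

Definition supp (f : nat -> nat) : {set 'I_n} := [set x : 'I_n | f x != 0].

Lemma eq_supp f g : (forall x, x < n -> (f x == 0) = (g x == 0)) -> supp f = supp g.
Proof. by move=> fg; apply/setP=> x; rewrite !inE fg. Qed.

Lemma card_supp_insert f g z : z < n -> f z = 0 ->
  (forall x, x < n -> (g x == 0) = (f x == 0) && (x != z)) ->
  #|supp g| = #|supp f|.+1.
Proof.
move=> zn fz gf; have -> : supp g = Ordinal zn |: supp f.
  by apply/setP=> x; rewrite !inE gf // negb_and negbK -val_eqE orbC.
by rewrite cardsU1 inE fz.
Qed.

Lemma card_supp_le f g : (forall x, x < n -> f x <= n) ->
  (forall x y, x < n -> y < n -> f x = y.+1 -> g y = x.+1) ->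
  #|supp f| <= #|supp g|.
Proof.
move=> fn fg; pose h (x : 'I_n) : 'I_n := insubd x (f x).-1.
have hE (x : 'I_n) : f x != 0 -> val (h x) = (f x).-1.
  move=> fx; rewrite /h val_insubd ifT //; have := fn _ (ltn_ord x).
  by case: (f x) fx.
have gh (x : 'I_n) : f x != 0 -> g (h x) = x.+1.
  by move=> fx; apply: fg => //; by rewrite -[nat_of_ord (h x)]/(val (h x)) hE // prednK // lt0n.
have hi : {in supp f &, injective h}.
  move=> x x'; rewrite !inE => /gh gx /gh gx' hh; apply/val_inj.
  by move: gx gx'; rewrite hh => -> /= [].
rewrite -(card_in_imset hi); apply/subset_leq_card/subsetP => _ /imsetP[x xf ->].
by rewrite inE in xf; rewrite inE gh.
Qed.

End Support.

Section Search.
Variables (n l : nat) (e : nat -> nat -> bool) (rank : nat -> nat).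

Record matching (jx jy : nat) (mx my : nat -> nat) : Prop := Matching {
  mx_le : forall x, x < n -> mx x <= n;
  my_le : forall y, y < n -> my y <= n;
  mateP : forall x y, x < n -> y < n -> mx x = y.+1 <-> my y = x.+1;
  mate_arc : forall x y, x < n -> y < n -> mx x = y.+1 ->
    [/\ e x y, rank x < jx & jy <= rank y]
}.

Lemma card_matching jx jy mx my : matching jx jy mx my ->
  #|supp n mx| = #|supp n my|.
Proof.
case=> mxn myn mate _; apply/eqP; rewrite eqn_leq.
by apply/andP; split; apply: card_supp_le => // x y xn yn; apply mate.
Qed.

(* Here X = {rank < jx} and Y = {jy <= rank}; the set S of the header consists of
   the [x] with [s x < n], and [y] is labelled when [a y < rank y - l].  The bound
   [js] is the current step, and [exc] is a vertex whose search is still due ([n]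
   if there is none). *)
Record state (jx jy js exc : nat) (mx my a s : nat -> nat) : Prop := State {
  state_matching : matching jx jy mx my;
  state_free : forall x, x < n -> x != exc -> rank x < jx -> mx x = 0 -> s x < n;
  state_arc : forall u v, u < n -> v < n -> e u v -> a v <= s u;
  state_a : forall v, v < n -> a v <= rank v - l;
  state_s : forall v, v < n -> rank v <= s v <= n;
  state_js : forall v, v < n -> s v < n -> s v < js /\ rank v < jx;
  state_label : forall y, y < n -> jy <= rank y -> a y < rank y - l -> my y != 0
}.

Definition same_history (j : nat) (a s a' s' : nat -> nat) : Prop :=
  forall v, v < n ->
    (forall i, i < j -> (a' v <= i) = (a v <= i)) /\
    (forall i, i <= j -> (i <= s' v) = (i <= s v)).

Record pending (j jx x0 : nat) (mx my a s : nat -> nat) : Prop := Pending {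
  pending_j : j < n;
  pending_jx : jx <= j.+1;
  pending_lt : x0 < n;
  pending_rank : rank x0 < jx;
  pending_free : mx x0 = 0;
  pending_s : s x0 = n;
  pending_state : state jx (j + l).+1 j.+1 x0 mx my a s
}.

Section Fixed.
Variables (j jx x0 : nat) (mx my a s : nat -> nat).

(* Breadth-first search from [x0] over the arcs to the unlabelled part of Y, along
   the matching back to X: [q] is the queue of the [tl] vertices reached in X, the
   first [h] of which are expanded; entry [h] has been compared with the vertices
   below [cur].  [par y] is 1 plus the vertex that reached [y], 0 if there is none,
   and [fnd] is 1 plus some unmatched vertex reached. *)
Record bfs (h cur : nat) (par q : nat -> nat) (tl fnd : nat) : Prop := Bfs {
  bfs_tl : tl = #|[set y : 'I_n | (par y != 0) && (my y != 0)]|.+1;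
  bfs_h : h <= tl;
  bfs_q0 : q 0 = x0;
  bfs_q : forall p, p < tl -> q p < n;
  bfs_mate : forall p, 0 < p < tl -> exists y p',
    [/\ y < n, p' < p, mx (q p) = y.+1 & par y = (q p').+1];
  bfs_inj : forall p p', p < p' < tl -> q p != q p';
  bfs_par : forall y, y < n -> par y != 0 -> j < a y /\
    exists2 p, p < tl & par y = (q p).+1 /\ e (q p) y;
  bfs_free : forall y, y < n -> par y != 0 -> my y = 0 -> fnd != 0;
  bfs_push : forall y, y < n -> par y != 0 -> my y != 0 ->
    exists2 p, 0 < p < tl & my y = (q p).+1;
  bfs_fnd : fnd != 0 -> exists y, [/\ y < n, fnd = y.+1, par y != 0 & my y = 0];
  bfs_done : forall p v, p < tl -> v < n -> (p < h) || (p == h) && (v < cur) ->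
    e (q p) v -> j < a v -> par v != 0
}.

Lemma bfs_start par q : x0 < n -> (forall v, v < n -> par v = 0) -> q 0 = x0 ->
  bfs 0 0 par q 1 0.
Proof.
move=> x0n par0 q0; split=> //.
- congr S; symmetry; apply/eqP; rewrite cards_eq0; apply/eqP/setP=> y.
  by rewrite !inE par0.
- by move=> [|p]; rewrite ?q0.
- by move=> [|p].
- by move=> p p'; lia.
- by move=> y yn; rewrite par0.
- by move=> y yn; rewrite par0.
- by move=> y yn; rewrite par0.
- by move=> p v _ _; rewrite andbF.
Qed.

Lemma bfs_skip h cur par q tl fnd : h < tl ->
  bfs h cur par q tl fnd ->
  [|| ~~ e (q h) cur, a cur <= j | par cur != 0] ->
  bfs h cur.+1 par q tl fnd.
Proof.
move=> ht [Htl Hh Hq0 Hq Hmate Hinj Hpar Hfree Hpush Hfnd Hdone] skip.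
split=> // p v pt vn ph ev jv.
have [/andP[/eqP pE /eqP vE]|pv] := boolP ((p == h) && (v == cur)).
  by subst p v; move: skip; rewrite ev leqNgt jv.
by apply: (Hdone p v) => //; lia.
Qed.

Lemma bfs_next h par q tl fnd : h < tl -> bfs h n par q tl fnd -> bfs h.+1 0 par q tl fnd.
Proof.
move=> ht [Htl Hh Hq0 Hq Hmate Hinj Hpar Hfree Hpush Hfnd Hdone]; split=> // p v pt vn ph.
by apply: Hdone => //; lia.
Qed.

Lemma bfs_visit_free h cur par q tl fnd : h < tl -> cur < n ->
  bfs h cur par q tl fnd ->
  e (q h) cur -> j < a cur -> par cur = 0 -> my cur = 0 ->
  bfs h cur.+1 (upd par cur (q h).+1) q tl cur.+1.
Proof.
move=> ht cn [Htl Hh Hq0 Hq Hmate Hinj Hpar Hfree Hpush Hfnd Hdone] eh ja par0 my0; split=> //.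
- rewrite Htl; congr S; apply: eq_card => y; rewrite !inE updE.
  by case: (eqVneq (nat_of_ord y) cur) => [->|] //; rewrite my0 par0 andbF.
- move=> p pt; have [y [p' [yn p'p mq py]]] := Hmate p pt.
  exists y, p'; split=> //; rewrite updE; case: (eqVneq y cur) => // yc.
  by rewrite -yc py in par0.
- move=> y yn; rewrite updE; case: (eqVneq y cur) => [->|_]; last exact: Hpar.
  by split=> //; exists h.
- move=> y yn; rewrite updE; case: (eqVneq y cur) => [->|_]; last exact: Hpush.
  by rewrite my0.
- by move=> _; exists cur; split=> //; rewrite updE eqxx.
- move=> p v pt vn ph ev jv; rewrite updE; case: (eqVneq v cur) => // vc.
  by apply: (Hdone p v) => //; lia.
Qed.

Hypothesis pend : pending j jx x0 mx my a s.
Let st := pending_state pend.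

Lemma bfs_tl_le h cur par q tl fnd : bfs h cur par q tl fnd -> tl <= #|supp n mx|.+1.
Proof.
case=> -> _ _ _ _ _ _ _ _ _ _; rewrite ltnS (card_matching (state_matching st)).
by apply/subset_leq_card/subsetP=> y; rewrite !inE => /andP[].
Qed.

Lemma bfs_visit_matched h cur x par q tl fnd : h < tl -> cur < n ->
  bfs h cur par q tl fnd ->
  e (q h) cur -> j < a cur -> par cur = 0 -> my cur = x.+1 ->
  bfs h cur.+1 (upd par cur (q h).+1) (upd q tl x) tl.+1 fnd.
Proof.
move=> ht cn [Htl Hh Hq0 Hq Hmate Hinj Hpar Hfree Hpush Hfnd Hdone] eh ja par0 my0.
have mt := state_matching st.
have xn : x < n by have := my_le mt cn; rewrite my0.
have mxx : mx x = cur.+1 by apply (mateP mt).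
have qold p : p < tl -> upd q tl x p = q p by rewrite updE; case: ltngtP.
have parold y : par y != 0 -> upd par cur (q h).+1 y = par y.
  by rewrite updE; case: (eqVneq y cur) => // ->; rewrite par0.
have xnew p : p < tl -> q p != x.
  move=> pt; apply/eqP=> qx; case: (posnP p) => [p0|p_gt0].
    by rewrite p0 Hq0 in qx; rewrite -qx (pending_free pend) in mxx.
  have pt' : 0 < p < tl by rewrite p_gt0.
  have [y [p' [_ _ +]]] := Hmate _ pt'; rewrite qx mxx => -[<-].
  by rewrite par0.
split.
- rewrite Htl; congr S.
  rewrite [RHS](cardsD1 (Ordinal cn)) inE /= updE eqxx my0 add1n; congr S.
  apply: eq_card => y; rewrite !inE -val_eqE /= updE.
  by case: (eqVneq (nat_of_ord y) cur) => [->|] //; rewrite par0.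
- lia.
- by rewrite qold //; lia.
- by move=> p; rewrite ltnS leq_eqVlt updE; case: (eqVneq p tl) => //= _; apply: Hq.
- move=> p /andP[p_gt0]; rewrite ltnS leq_eqVlt => /orP[/eqP->|pt].
    exists cur, h; split=> //; first by rewrite updE eqxx.
    by rewrite updE eqxx qold.
  have pt' : 0 < p < tl by rewrite p_gt0.
  have [y [p' [yn p'p mq py]]] := Hmate _ pt'; exists y, p'; split=> //.
    by rewrite qold.
  by rewrite parold ?py // qold //; lia.
- move=> p p' /andP[pp']; rewrite ltnS leq_eqVlt => /orP[/eqP p't|p't].
    by rewrite p't qold ?updE ?eqxx ?xnew // -p't.
  by rewrite !qold ?Hinj ?pp' //; lia.
- move=> y yn; rewrite updE; case: (eqVneq y cur) => [->|_] py.
    by split=> //; exists h; rewrite ?qold //; lia.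
  have [jy' [p pt [pE ep]]] := Hpar y yn py; split=> //.
  by exists p; rewrite ?qold //; lia.
- move=> y yn; rewrite updE; case: (eqVneq y cur) => [->|_]; last exact: Hfree.
  by rewrite my0.
- move=> y yn; rewrite updE; case: (eqVneq y cur) => [->|_] py.
    by exists tl; rewrite ?updE ?eqxx //; lia.
  by move=> my1; have [p pt mp] := Hpush y yn py my1; exists p; rewrite ?qold //; lia.
- move=> /Hfnd[y [yn fy py my1]]; exists y; split=> //.
  by rewrite parold.
- move=> p v pt vn ph ev jv; rewrite updE; case: (eqVneq v cur) => // vc.
  have pt' : p < tl by lia.
  by apply: (Hdone p v) => //; [lia | rewrite qold in ev].
Qed.

Section Finish.
Variables (par q : nat -> nat) (tl fnd : nat).
Hypothesis fin : bfs tl 0 par q tl fnd.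

(* The matching while the alternating path ending in [y] is being flipped:
   [y] awaits its new mate, the queue entry [q p]. *)
Record flip (p y : nat) (mx' my' : nat -> nat) : Prop := Flip {
  flip_y : y < n;
  flip_p : p < tl;
  flip_par : par y = (q p).+1;
  flip_mx : forall x, x < n -> mx' x <= n;
  flip_my : forall y', y' < n -> my' y' <= n;
  flip_mate : forall x y', x < n -> y' < n -> y' != y -> mx' x = y'.+1 <-> my' y' = x.+1;
  flip_nomate : forall x, x < n -> mx' x != y.+1;
  flip_arc : forall x y', x < n -> y' < n -> mx' x = y'.+1 ->
    [/\ e x y', rank x < jx & j + l < rank y'];
  flip_old : forall p', p' <= p -> mx' (q p') = mx (q p');
  flip_free : forall x, x < n -> (mx' x == 0) = (mx x == 0);
  flip_matched : forall y', y' < n -> y' != y -> my y' != 0 -> my' y' != 0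
}.

Lemma flip_start : fnd != 0 -> exists p, flip p fnd.-1 mx my.
Proof.
move=> /(bfs_fnd fin)[y [yn -> py my0]] /=.
have [_ [p pt [pE ep]]] := bfs_par fin yn py.
have [mxn myn mate arc] := state_matching st.
exists p; split=> //.
  by move=> x y' xn yn' _; apply mate.
by move=> x xn; apply/eqP=> /(mate x y xn yn); rewrite my0.
Qed.

Lemma flip_pair p y mx' my' : flip p y mx' my' ->
  [/\ q p < n, e (q p) y, rank (q p) < jx & j + l < rank y].
Proof.
case=> yn pt py _ _ _ _ _ _ _ _.
have py0 : par y != 0 by rewrite py.
have [ja [p' _ [pE ep]]] := bfs_par fin yn py0.
rewrite pE in py; case: py => qq; rewrite qq in ep.
split=> //; first exact: (bfs_q fin).
  have [p0|p_gt0] := posnP p; first by rewrite p0 (bfs_q0 fin) (pending_rank pend).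
  have pt' : 0 < p < tl by rewrite p_gt0.
  have [y' [_ [yn' _ mq _]]] := bfs_mate fin pt'.
  by have [] := mate_arc (state_matching st) (bfs_q fin pt) yn' mq.
have := state_a st yn; lia.
Qed.

Lemma flip_step p y mx' my' : flip p y mx' my' -> 0 < p ->
  exists p' y', [/\ p' < p, mx' (q p) = y'.+1 &
    flip p' y' (upd mx' (q p) y.+1) (upd my' y (q p).+1)].
Proof.
move=> fl p_gt0; have [qn eq rq ry] := flip_pair fl.
case: fl => yn pt py mxn myn mate nomate arc old free matched.
have pt' : 0 < p < tl by rewrite p_gt0.
have [y2 [p2 [y2n p2p mq py2]]] := bfs_mate fin pt'.
have mq' : mx' (q p) = y2.+1 by rewrite old.
have yy2 : y2 != y by apply: contraNneq (nomate _ qn) => <-; rewrite mq'.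
exists p2, y2; split=> //; split=> //.
- by lia.
- by move=> x xn; rewrite updE; case: ifP => // _; apply: mxn.
- by move=> x xn; rewrite updE; case: ifP => // _; apply: myn.
- move=> x y' xn y'n y'y2; rewrite !updE.
  case: (eqVneq y' y) => [->|y'y]; case: (eqVneq x (q p)) => [->|xq] //.
  + by split=> [xy|[xq']]; [have := nomate _ xn; rewrite xy eqxx | rewrite xq' eqxx in xq].
  + split=> [[yE]|/(mate _ _ qn y'n y'y)]; first by rewrite yE eqxx in y'y.
    by rewrite mq' => -[yE]; rewrite yE eqxx in y'y2.
  + exact: mate.
- move=> x xn; rewrite updE; case: (eqVneq x (q p)) => [_|xq].
    by apply: contraNneq yy2 => -[->].
  apply/eqP=> /(mate _ _ xn y2n yy2) mE.
  have /(mate _ _ qn y2n yy2) := mq'; rewrite mE => -[xE].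
  by rewrite xE eqxx in xq.
- move=> x y' xn y'n; rewrite updE; case: (eqVneq x (q p)) => [->|xq]; last exact: arc.
  by case=> <-.
- move=> p' p'p2; have p'p : p' < p by lia.
  rewrite updE ifN ?old //; first by lia.
  by apply: (bfs_inj fin); rewrite p'p.
- move=> x xn; rewrite updE; case: (eqVneq x (q p)) => [->|xq]; last exact: free.
  by rewrite mq.
- move=> y' y'n y'y2; rewrite updE; case: (eqVneq y' y) => [->|y'y] //.
  exact: matched.
Qed.

Lemma flip_last y mx' my' : flip 0 y mx' my' ->
  mx' (q 0) = 0 /\
  state jx (j + l).+1 j.+1 n (upd mx' (q 0) y.+1) (upd my' y (q 0).+1) a s /\
  #|supp n (upd mx' (q 0) y.+1)| = #|supp n mx|.+1.
Proof.
move=> fl; have [qn eq rq ry] := flip_pair fl.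
case: fl => yn pt py mxn myn mate nomate arc old free matched.
have mq : mx' (q 0) = 0 by rewrite old // (bfs_q0 fin) (pending_free pend).
split=> //; split; last first.
  rewrite (@card_supp_insert n mx' (upd mx' (q 0) y.+1) (q 0)) //.
    by congr S; rewrite (eq_supp free).
  by move=> x xn; rewrite updE; case: (eqVneq x (q 0)); rewrite ?andbT ?andbF.
split; try by case: st.
- split.
  + by move=> x xn; rewrite updE; case: ifP => // _; apply: mxn.
  + by move=> x xn; rewrite updE; case: ifP => // _; apply: myn.
  + move=> x y' xn y'n; rewrite !updE.
    case: (eqVneq y' y) => [->|y'y]; case: (eqVneq x (q 0)) => [->|xq] //.
    * by split=> [xy|[xq']]; [have := nomate _ xn; rewrite xy eqxx | rewrite xq' eqxx in xq].
    * split=> [[yE]|/(mate _ _ qn y'n y'y)]; first by rewrite yE eqxx in y'y.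
      by rewrite mq.
    * exact: mate.
  + move=> x y' xn y'n; rewrite updE; case: (eqVneq x (q 0)) => [->|xq]; last exact: arc.
    by case=> <-.
- move=> x xn _ rx; rewrite updE; case: (eqVneq x (q 0)) => // xq /eqP.
  rewrite free // => /eqP; apply: (state_free st) => //.
  by rewrite -(bfs_q0 fin).
- move=> y' y'n jy' ay'; rewrite updE; case: (eqVneq y' y) => // y'y.
  by apply: matched => //; apply: (state_label st).
Qed.

Definition marked (i x : nat) : bool := (0 < mx x <= i) && (par (mx x).-1 != 0).

Lemma bfs_fail a' s' : fnd = 0 ->
  (forall v, v < n -> a' v = if par v != 0 then j else a v) ->
  (forall x, x < n -> s' x = if (x == x0) || marked n x then j else s x) ->
  state jx (j + l).+1 j.+1 n mx my a' s' /\ same_history j a s a' s'.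
Proof.
move=> fnd0 a'E s'E.
have [j_lt jx_le x0_lt x0_rank x0_free x0_s [mt free arc sa ss js lab]] := pend.
have parn v : v < n -> par v != 0 -> j < a v by move=> vn /(bfs_par fin vn)[].
have a'_le v : v < n -> a' v <= a v.
  by move=> vn; rewrite a'E //; case: ifP => // /(parn _ vn)/ltnW.
have mark x : x < n -> (x == x0) || marked n x ->
  [/\ rank x < jx, s x = n & exists2 p, p < tl & q p = x].
  move=> xn /orP[/eqP->|/andP[/andP[m_gt0 m_n] pm]].
    by split=> //; exists 0; rewrite ?(bfs_q0 fin) // (bfs_tl fin).
  have yn : (mx x).-1 < n by lia.
  have mE : mx x = (mx x).-1.+1 by lia.
  have [exy rx _] := mate_arc mt xn yn mE.
  split=> //.
    have := arc _ _ xn yn exy; have := parn _ yn pm; have := js _ xn.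
    have := ss _ xn; case: ltngtP => //; lia.
  have /(mateP mt xn yn) myx := mE.
  have myx0 : my (mx x).-1 != 0 by rewrite myx.
  have [p pt] := bfs_push fin yn pm myx0; rewrite myx => -[->].
  by exists p => //; case/andP: pt.
have s'_le v : v < n -> s' v <= s v.
  move=> vn; rewrite s'E //; case: ifP => // /(mark _ vn)[_ -> _].
  exact: ltnW.
split; first split=> //.
- move=> x xn _ rx mx0; rewrite s'E //; case: (eqVneq x x0) => //= xx0.
  by rewrite /marked mx0 /=; apply: free.
- move=> u v un vn uv; rewrite s'E //; case: ifP => [/(mark _ un)[_ _ [p pt qp]]|_].
    rewrite a'E //; case: ifP => // /negbFE/eqP pv.
    rewrite leqNgt; apply/negP=> jv.
    have := bfs_done fin pt vn; rewrite pt qp => /(_ isT uv jv).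
    by rewrite pv.
  exact: leq_trans (a'_le _ vn) (arc _ _ un vn uv).
- by move=> v vn; apply: leq_trans (a'_le _ vn) (sa _ vn).
- move=> v vn; rewrite s'E //; case: ifP => [/(mark _ vn)[rv _ _]|_]; last exact: ss.
  by lia.
- move=> v vn; rewrite s'E //; case: ifP => [/(mark _ vn)[rv _ _]|_]; last exact: js.
  by [].
- move=> y yn jy'; rewrite a'E //; case: ifP => [py _|_]; last exact: lab.
  by apply/eqP=> my0; have := bfs_free fin yn py my0; rewrite fnd0.
move=> v vn; split=> i ij.
  rewrite a'E //; case: ifP => // /(parn _ vn); lia.
rewrite s'E //; case: ifP => // /(mark _ vn)[_ -> _]; lia.
Qed.

End Finish.
End Fixed.
End Search.

Section Iteration.
Variables (n l : nat) (e : nat -> nat -> bool) (rank : nat -> nat).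
Hypothesis rank_inj : forall u v, u < n -> v < n -> rank u = rank v -> u = v.

Lemma state_shrink j mx my a s : state n l e rank j (j + l) j n mx my a s ->
  (forall y, y < n -> rank y = j + l -> my y = 0) ->
  state n l e rank j (j + l).+1 j.+1 n mx my a s.
Proof.
case=> -[mxn myn mate arc] free sarc sa ss js lab y0; split=> //.
- split=> // x y xn yn mxy; have [exy rx ry] := arc x y xn yn mxy; split=> //.
  rewrite ltn_neqAle ry andbT; apply/eqP=> ry'.
  by have /(mate x y xn yn) := mxy; rewrite y0.
- by move=> v vn /(js v vn)[sv rv]; split=> //; exact: ltnW.
- by move=> y yn ry; apply: lab => //; exact: ltnW.
Qed.

Lemma state_unmatch j x y mx my a s : state n l e rank j (j + l) j n mx my a s ->
  y < n -> rank y = j + l -> my y = x.+1 ->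
  state n l e rank j (j + l).+1 j.+1 x (upd mx x 0) (upd my y 0) a s /\
  #|supp n mx| = #|supp n (upd mx x 0)|.+1.
Proof.
case=> -[mxn myn mate arc] free sarc sa ss js lab yn ry my_y.
have xn : x < n by have := myn _ yn; rewrite my_y.
have mx_x : mx x = y.+1 by apply (mate x y).
split; last first.
  apply: (@card_supp_insert n _ _ x) => //; first by rewrite updE eqxx.
  by move=> x' x'n; rewrite updE; case: (eqVneq x' x) => [->|_]; rewrite ?mx_x ?andbF ?andbT.
split=> //.
- split.
  + by move=> x' x'n; rewrite updE; case: ifP => // _; exact: mxn.
  + by move=> x' x'n; rewrite updE; case: ifP => // _; exact: myn.
  + move=> x' y' x'n y'n; rewrite !updE.
    case: (eqVneq x' x) => [->|x'x]; case: (eqVneq y' y) => [->|y'y] //.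
    * by split=> // /(mate x y' xn y'n); rewrite mx_x => -[yy]; rewrite yy eqxx in y'y.
    * by split=> // /(mate x' y x'n yn); rewrite my_y => -[xx]; rewrite xx eqxx in x'x.
    * exact: mate.
  + move=> x' y' x'n y'n; rewrite updE; case: (eqVneq x' x) => // x'x mxy.
    have [exy rx ry'] := arc x' y' x'n y'n mxy; split=> //.
    rewrite ltn_neqAle ry' andbT; apply/eqP=> rr.
    have yy : y = y' by apply: rank_inj => //; rewrite ry.
    have /(mate x' y' x'n y'n) := mxy; rewrite -yy my_y => -[xx].
    by rewrite xx eqxx in x'x.
- move=> x' x'n x'x rx; rewrite updE (negPf x'x); apply: free => //.
  by rewrite neq_ltn x'n.
- by move=> v vn /(js v vn)[sv rv]; split=> //; exact: ltnW.
- move=> y' y'n ry' ay'; rewrite updE; case: (eqVneq y' y) => [yy|_].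
    by move: ry'; rewrite yy ry ltnn.
  by apply: lab => //; exact: ltnW.
Qed.

Lemma state_known jx jy js x mx my a s : state n l e rank jx jy js x mx my a s ->
  s x < n -> state n l e rank jx jy js n mx my a s.
Proof.
case=> mt free sarc sa ss js' lab sx; split=> // x' x'n _ rx mx0.
by have [->|xx] := eqVneq x' x; [exact: sx | exact: free].
Qed.

Lemma state_pending j x mx my a s : state n l e rank j (j + l).+1 j.+1 x mx my a s ->
  j < n -> x < n -> rank x < j -> mx x = 0 -> s x = n ->
  pending n l e rank j j x mx my a s.
Proof. by move=> st *; split=> //; lia. Qed.

Lemma state_grow j x mx my a s : state n l e rank j (j + l).+1 j.+1 n mx my a s ->
  j < n -> x < n -> rank x = j -> pending n l e rank j j.+1 x mx my a s.
Proof.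
case=> -[mxn myn mate arc] free sarc sa ss js lab jn xn rx.
have mx0 : mx x = 0.
  case mxE : (mx x) => [//|y]; have yn : y < n by have := mxn _ xn; rewrite mxE.
  by have [_ + _] := arc x y xn yn mxE; rewrite rx ltnn.
have sx : s x = n.
  have /andP[_] := ss _ xn; rewrite leq_eqVlt => /orP[/eqP //|/(js _ xn)[_]].
  by rewrite rx ltnn.
split=> //; first by rewrite rx.
split=> //.
- split=> // x' y x'n yn mxy; have [? ? ?] := arc _ _ x'n yn mxy; split=> //.
  exact: leqW.
- move=> x' x'n x'x; rewrite ltnS leq_eqVlt => /orP[/eqP rr|rr].
    by move/eqP: x'x; case; apply: rank_inj; rewrite ?rx.
  by apply: free => //; rewrite neq_ltn x'n.
- by move=> v vn /(js v vn)[sv rv]; split=> //; exact: leqW.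
Qed.

Lemma card_window j : #|[set v : 'I_n | j <= rank v <= j + l]| <= l.+1.
Proof.
pose f (v : 'I_n) : 'I_l.+1 := inord (rank v - j).
rewrite -[X in _ <= X]card_ord -(card_in_imset (f := f)); first exact: max_card.
move=> u v; rewrite !inE => uj vj /(congr1 (@nat_of_ord _)); rewrite /f !inordK; try lia.
by move=> ruv; apply/ord_inj/rank_inj => //; lia.
Qed.

Lemma card_bag k j mx my a s mx' my' a' s' :
  state n l e rank j (j + l) j n mx my a s -> #|supp n mx| <= k ->
  state n l e rank j.+1 (j.+1 + l) j.+1 n mx' my' a' s' -> #|supp n mx'| <= k ->
  (forall v, v < n -> (j <= s' v) = (j <= s v)) ->
  #|[set v : 'I_n | a' v <= j <= s' v]| <= (l + 2 * k).+1.
Proof.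
move=> st ck st' ck' ss'.
apply: leq_trans (_ : #|[set v : 'I_n | j <= rank v <= j + l] :|: (supp n mx :|: supp n my')| <= _).
  apply/subset_leq_card/subsetP=> v; rewrite !inE ss' // => /andP[av sv].
  have [rj|rj] /= := leqP j (rank v); last first.
    apply/orP; left; apply/eqP=> mx0.
    have vn : v != n :> nat by rewrite neq_ltn ltn_ord.
    have := state_free st (ltn_ord v) vn rj mx0.
    by move/(state_js st (ltn_ord v)) => -[]; lia.
  case: leqP => //= rjl; apply/orP; right; apply: (state_label st') => //; lia.
rewrite (card_matching (state_matching st')) in ck'.
have -> : (l + 2 * k).+1 = l.+1 + (k + k) by lia.
apply: leq_trans (leq_card_setU _ _) (leq_add (card_window j) _).
exact: leq_trans (leq_card_setU _ _) (leq_add ck ck').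
Qed.

End Iteration.

(** * The search as a program *)

(* Vertex [v] lies in the bags of index [aIn v] to [aOut v].  Mates (aMx from X to
   Y, aMy from Y to X), parents and the position of a degree tangle are stored with
   1 added, so that the initial value 0 means none. *)
Notation aAdj := 1 (only parsing).
Notation aRow := 2 (only parsing).
Notation aDeg := 3 (only parsing).
Notation aRank := 4 (only parsing).
Notation aOrd := 5 (only parsing).
Notation aIn := 6 (only parsing).
Notation aOut := 7 (only parsing).
Notation aMx := 8 (only parsing).
Notation aMy := 9 (only parsing).
Notation aPar := 10 (only parsing).
Notation aQueue := 11 (only parsing).
Notation vJ := 12 (only parsing).
Notation vCnt := 13 (only parsing).
Notation vHead := 14 (only parsing).
Notation vTail := 15 (only parsing).
Notation vFnd := 16 (only parsing).
Notation vI := 17 (only parsing).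
Notation vW := 18 (only parsing).
Notation vX := 19 (only parsing).
Notation vTmp := 20 (only parsing).
Notation vY := 21 (only parsing).
Notation vZ := 22 (only parsing).
Notation vTangle := 23 (only parsing).
Notation aKey := 24 (only parsing).

Notation "a ::= e" := (Assign a (Const 0) e) (at level 60, no associativity).
Notation When e c := (If e c Skip).
Notation search_vars :=
  [:: aIn; aOut; aMx; aMy; aPar; aQueue; vCnt; vHead; vTail; vFnd; vW; vTmp; vY; vZ].

Definition scan : cmd :=
  For vW
    (When (Cell aAdj (Plus (Cell aRow (Cell aQueue (Var vHead))) (Var vW)))
      (When (Minus (Cell aIn (Var vW)) (Var vJ))
        (If (Cell aPar (Var vW)) Skip
          (Assign aPar (Var vW) (Plus (Cell aQueue (Var vHead)) (Const 1)) ;;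
           If (Cell aMy (Var vW))
             (Assign aQueue (Var vTail) (Minus (Cell aMy (Var vW)) (Const 1)) ;;
              vTail ::= Plus (Var vTail) (Const 1))
             (vFnd ::= Plus (Var vW) (Const 1)))))).

Definition explore : cmd :=
  While (Minus (Var vTail) (Var vHead))
    (scan ;; vHead ::= Plus (Var vHead) (Const 1)).

Definition augment : cmd :=
  vY ::= Var vFnd ;;
  While (Var vY)
    (vZ ::= Minus (Cell aPar (Minus (Var vY) (Const 1))) (Const 1) ;;
     vTmp ::= Cell aMx (Var vZ) ;;
     Assign aMx (Var vZ) (Var vY) ;;
     Assign aMy (Minus (Var vY) (Const 1)) (Plus (Var vZ) (Const 1)) ;;
     vY ::= Var vTmp).

Definition mark : cmd :=
  For vW
    (When (Cell aPar (Var vW))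
      (Assign aIn (Var vW) (Var vJ) ;;
       Assign aOut (Minus (Cell aMy (Var vW)) (Const 1)) (Var vJ))) ;;
  Assign aOut (Var vX) (Var vJ).

Definition search : cmd :=
  For vW (Assign aPar (Var vW) (Const 0)) ;;
  Assign aQueue (Const 0) (Var vX) ;;
  vHead ::= Const 0 ;;
  vTail ::= Const 1 ;;
  vFnd ::= Const 0 ;;
  explore ;;
  If (Var vFnd) (augment ;; vCnt ::= Plus (Var vCnt) (Const 1)) mark.

Ltac step := match goal with
  | |- runs _ (Seq _ _) _ _ _ => apply: runs_seq
  | |- runs _ (Assign _ _ _) _ _ _ => apply: runs_assign => /=
  | |- runs _ (If _ _ _) _ _ _ => apply: runs_if => /=
  | |- runs _ Skip _ _ _ => apply: runs_skip
  | |- runs _ (Emit _) _ _ _ => apply: runs_emit => /=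
  end.

Ltac unframe fr := repeat match goal with |- context [?m ?a _] => rewrite (fr a isT) end.

Section Specs.
Variables (B n k l : nat) (e : nat -> nat -> bool) (rank ord : nat -> nat).
Hypothesis B_ge : n * n + n + 3 <= B.

Record loaded (m : memory) : Prop := Loaded {
  loaded_n : m 0 0 = n;
  loaded_k : m 0 1 = k;
  loaded_l : m 0 2 = l;
  loaded_adj : forall u v, u < n -> v < n -> (m aAdj (m aRow u + v) != 0) = e u v;
  loaded_rank : forall v, v < n -> m aRank v = rank v;
  loaded_ord : forall p, p < n -> m aOrd p = ord p
}.

Lemma loaded_frame s m m' : all (fun a => a \notin s) [:: 0; 1; 2; 4; 5] ->
  frame s m m' -> loaded m -> loaded m'.
Proof.
by move=> /and5P[s0 s1 s2 s4 /andP[s5 _]] fr [*]; split; rewrite !fr.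
Qed.

Section Search.
Variables (j jx x0 : nat) (m0 : memory).
Hypothesis loaded0 : loaded m0.
Hypothesis m0_j : m0 vJ 0 = j.
Hypothesis m0_x : m0 vX 0 = x0.
Hypothesis pend : pending n l e rank j jx x0 (m0 aMx) (m0 aMy) (m0 aIn) (m0 aOut).

Definition explored (h cur : nat) (m : memory) : Prop :=
  [/\ frame [:: aPar; aQueue; vHead; vTail; vFnd; vW] m0 m, m vHead 0 = h &
      bfs n e j x0 (m0 aMx) (m0 aMy) (m0 aIn) h cur (m aPar) (m aQueue) (m vTail 0) (m vFnd 0)].

Lemma scan_spec h m o : explored h 0 m -> h < m vTail 0 ->
  runs B scan m o (fun t m' o' =>
    [/\ t <= 12 * n + 2, o' = o & explored h n m' /\ h < m' vTail 0]).
Proof.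
move=> ex ht.
apply: (@runs_for B vW _ n 10 (fun cur m o' =>
  o' = o /\ explored h cur m /\ h < m vTail 0)) => //.
- lia.
- by case: ex => fr _ _; rewrite fr // (loaded_n loaded0).
- split=> //; split=> //; case: ex => fr mh bf; split=> //.
  exact: frame_trans fr (frame_update _ _ _ _).
- move=> cur m1 o1 cn m1n m1w [-> [[fr mh bf] ht1]].
  have qn : m1 aQueue h < n by case: bf => *; auto.
  have adj : (m1 aAdj (m1 aRow (m1 aQueue h) + cur) != 0) = e (m1 aQueue h) cur.
    by unframe fr; rewrite (loaded_adj loaded0).
  have fin m2 t : t <= 10 -> frame [:: aPar; aQueue; vHead; vTail; vFnd; vW] m1 m2 ->
    m2 vHead 0 = h -> m2 vW 0 = cur -> h < m2 vTail 0 ->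
    bfs n e j x0 (m0 aMx) (m0 aMy) (m0 aIn) h cur.+1
      (m2 aPar) (m2 aQueue) (m2 vTail 0) (m2 vFnd 0) ->
    [/\ t <= 10, m2 0 0 = n, m2 vW 0 = cur &
      o = o /\ explored h cur.+1 (update m2 vW 0 cur.+1) /\ h < update m2 vW 0 cur.+1 vTail 0].
    move=> t10 fr2 m2h m2w ht2 bf2; split=> //; first by rewrite fr2.
    split=> //; split=> //; split=> //.
    by apply: frame_trans fr (frame_trans fr2 _); apply: frame_update.
  have skip : [|| ~~ e (m1 aQueue h) cur, m0 aIn cur <= j | m1 aPar cur != 0] ->
    bfs n e j x0 (m0 aMx) (m0 aMy) (m0 aIn) h cur.+1 (m1 aPar) (m1 aQueue) (m1 vTail 0) (m1 vFnd 0).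
    by apply: bfs_skip.
  step; rewrite ?mh ?m1w ?adj; last first.
    move/eqP=> ne; step; apply: fin => //; apply: skip.
    by rewrite -adj ne.
  move=> eh; step; rewrite m1w; unframe fr; rewrite m0_j; last first.
    move=> ja; step; apply: fin => //; apply: skip.
    by apply/or3P/Or32; lia.
  move=> ja; step; rewrite m1w.
    move=> pv; step; apply: fin => //; apply: skip.
    by rewrite pv !orbT.
  move=> pv; step; step; first by rewrite mh; lia.
  rewrite mh addn1.
  step; rewrite !updateE /= m1w; unframe fr.
    case myE : (m0 aMy cur) => [|x] // _.
    step; step; rewrite !updateE /= m1w; unframe fr; rewrite myE ?subn1 /=.
      by have := my_le (state_matching (pending_state pend)) cn; lia.
    step; rewrite !updateE /=; first by have := bfs_tl_le pend bf;
      have := max_card (supp n (m0 aMx)); rewrite card_ord; lia.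
    rewrite !addn1; apply: fin => //.
    + by do !apply: frame_trans (frame_update _ _ _ _).
    + by rewrite updateE /=; lia.
    + by apply: (bfs_visit_matched pend ht1 cn bf eh _ pv myE); lia.
  have w : update m1 aPar cur (m1 aQueue h).+1 vW 0 = cur by rewrite updateE.
  move=> myE; step; rewrite w addn1; first by lia.
  apply: fin => //.
  + by do !apply: frame_trans (frame_update _ _ _ _).
  + by apply: (bfs_visit_free ht1 cn bf eh _ pv myE); lia.
- by move=> t m' o' tT _ _ [-> [ex' ht']]; split=> //; lia.
Qed.

Lemma explore_spec m o : explored 0 0 m ->
  runs B explore m o (fun t m' o' =>
    [/\ t <= (#|supp n (m0 aMx)|.+1) * (12 * n + 5) + 1, o' = o & explored (m' vTail 0) 0 m']).
Proof.
move=> ex0.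
pose I r m o' := [/\ o' = o, explored (m vHead 0) 0 m, m vHead 0 <= m vTail 0
   & r = #|supp n (m0 aMx)|.+1 - m vHead 0].
have tl_le h cur m1 : explored h cur m1 -> m1 vTail 0 <= #|supp n (m0 aMx)|.+1.
  by case=> _ _ /(bfs_tl_le pend).
apply: (@runs_while B _ _ (12 * n + 4) I #|supp n (m0 aMx)|.+1).
- move=> r m1 o1 [-> ex le_ht rE] /= lt_ht.
  step; have ht : m1 vHead 0 < m1 vTail 0 by lia.
  apply: runs_weaken (scan_spec _ ex ht) _ => t m2 o2 [tT -> [ex2 ht2]].
  have [fr mh bf] := ex2.
  step; rewrite mh !addn1.
    by have := tl_le _ _ _ ex2; have := max_card (supp n (m0 aMx)); rewrite card_ord; lia.
  split; first lia.
  exists (#|supp n (m0 aMx)|.+1 - (m1 vHead 0).+1).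
    by have := tl_le _ _ _ ex; lia.
  split=> //; split=> //.
    by apply: frame_trans fr (frame_update _ _ _ _).
  exact: bfs_next.
- by split=> //; have [_ -> _] := ex0; rewrite ?subn0.
- move=> t r m1 o1 tT [-> ex le_ht _] /= ht0; split=> //; first by rewrite (addnS _ 4).
  by have <- : m1 vHead 0 = m1 vTail 0 by lia.
Qed.

Lemma augment_spec m o : explored (m vTail 0) 0 m -> m vFnd 0 != 0 ->
  runs B augment m o (fun t m' o' =>
    [/\ t <= (#|supp n (m0 aMx)|.+1) * 6 + 2, o' = o,
       frame [:: aMx; aMy; vTmp; vY; vZ] m m',
       state n l e rank jx (j + l).+1 j.+1 n (m' aMx) (m' aMy) (m' aIn) (m' aOut) &
       #|supp n (m' aMx)| = #|supp n (m0 aMx)|.+1]).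
Proof.
move=> ex fnd; have [fr _ bf] := ex.
have [_ [y0 [y0n y0E _ _]]] := (fnd, bfs_fnd bf fnd).
pose J m' := frame [:: aMx; aMy; vTmp; vY; vZ] m m'.
pose I r m' o' := [/\ o' = o, J m' &
  (exists p, [/\ m' vY 0 != 0, r = p.+1 &
     flip n l e rank j jx (m0 aMx) (m0 aMy) (m aPar) (m aQueue) (m vTail 0)
       p (m' vY 0).-1 (m' aMx) (m' aMy)])
  \/ [/\ m' vY 0 = 0, r = 0,
     state n l e rank jx (j + l).+1 j.+1 n (m' aMx) (m' aMy) (m0 aIn) (m0 aOut) &
       #|supp n (m' aMx)| = #|supp n (m0 aMx)|.+1]].
have [p0 fl0] := flip_start pend bf fnd.
have p0_lt : p0.+1 <= #|supp n (m0 aMx)|.+1.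
  exact: leq_trans (flip_p fl0) (bfs_tl_le pend bf).
rewrite /augment; step; step; first by rewrite y0E; lia.
apply: (@runs_while B _ _ 5 I p0.+1).
- move=> r m1 o1 [-> fr1 [[p [y_neq0 rE fl]]|[y_0 _ _ _]]] /=; last by rewrite y_0.
  move=> _.
  have [y yE] : exists y, m1 vY 0 = y.+1 by exists (m1 vY 0).-1; lia.
  rewrite yE /= in fl; have yn := flip_y fl.
  have parE : m1 aPar y = (m aQueue p).+1 by unframe fr1; rewrite (flip_par fl).
  have [qn _ _ _] := flip_pair pend bf fl.
  have mxn := flip_mx fl qn.
  step; step; rewrite yE !subn1 /= parE /=; first lia.
  step; step; rewrite !updateE /=; first lia.
  step; step; rewrite ?updateE /= ?yE; first lia.
  step; step; rewrite ?updateE /= ?yE ?subn1 ?addn1 /=; first lia.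
  step; rewrite ?updateE /=; first lia.
  split=> //; set m2 := update _ vY 0 _.
  have fr2 : J m2 by apply: frame_trans fr1 _; do !apply: frame_trans (frame_update _ _ _ _).
  have [p_0|p_gt0] := posnP p.
    rewrite p_0 in fl; have [mq [st' cs]] := flip_last pend bf fl.
    exists 0; first by rewrite rE.
    split=> //; right; split=> //; rewrite /m2 ?p_0 //.
  have [p' [y' [pp' mq fl']]] := flip_step pend bf fl p_gt0.
  exists p'.+1; first by rewrite rE.
  split=> //; left; exists p'; split=> //; rewrite /m2 ?updateE /= mq //.
- split=> //; try by apply: frame_update.
  have mxE : m aMx = m0 aMx by rewrite fr.
  have myE : m aMy = m0 aMy by rewrite fr.
  left; exists p0; split=> //.
  by rewrite -[update _ _ _ _ aMx]/(m aMx) -[update _ _ _ _ aMy]/(m aMy) mxE myE.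
- move=> t r m1 o1 tT [-> fr1 H] /= y_0.
  case: H => [[p [+ _ _]]|[_ _ st' cs]]; first by rewrite y_0.
  split=> //; last by rewrite (fr1 aIn) // (fr1 aOut) // !fr.
  apply: leq_trans (_ : p0.+1 * 6 + 2 <= _); [lia|rewrite leq_add2r leq_mul2r; exact: p0_lt].
Qed.

Lemma mark_spec m o : explored (m vTail 0) 0 m -> m vFnd 0 = 0 ->
  runs B mark m o (fun t m' o' =>
    [/\ t <= 5 * n + 4, o' = o, frame [:: aIn; aOut; vW] m m',
       state n l e rank jx (j + l).+1 j.+1 n (m' aMx) (m' aMy) (m' aIn) (m' aOut) &
       same_history n j (m0 aIn) (m0 aOut) (m' aIn) (m' aOut)]).
Proof.
move=> ex fnd; have [fr _ bf] := ex; have [jn jxj x0n x0r x0f x0s st] := pend.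
have mt := state_matching st.
rewrite /mark; step.
pose I i m' (o' : seq nat) := [/\ o' = o, frame [:: aIn; aOut; vW] m m',
  forall v, v < n -> m' aIn v = if (v < i) && (m aPar v != 0) then j else m0 aIn v &
  forall x, x < n -> m' aOut x = if marked (m0 aMx) (m aPar) i x then j else m0 aOut x].
apply: (@runs_for B vW _ n 3 I) => //; first lia.
- by unframe fr; rewrite (loaded_n loaded0).
- split=> // [|v vn|x xn].
  + exact: frame_update.
  + by rewrite -fr.
  + by rewrite /marked; case: (m0 aMx x); rewrite -fr.
- move=> i m1 o1 i_n m1n m1w [-> fr1 inE outE].
  have par_i : m1 aPar i = m aPar i by unframe fr1.
  have jE : m1 vJ 0 = j by unframe fr1; unframe fr; rewrite m0_j.
  have myE : m1 aMy = m0 aMy by rewrite fr1 // fr.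
  step; rewrite m1w par_i => pi.
    have my0 : m0 aMy i != 0.
      by apply/eqP=> my0; have := bfs_free bf i_n pi my0; rewrite fnd.
    have [x xE] : exists x, m0 aMy i = x.+1 by exists (m0 aMy i).-1; lia.
    have xn : x < n by have := my_le mt i_n; rewrite xE.
    have mxx : m0 aMx x = i.+1 by apply (mateP mt).
    step; step; rewrite ?updateE /= jE; first lia.
    step; rewrite ?updateE /= jE ?m1w ?myE ?xE ?subn1 /=; first lia.
    split=> //; split=> //.
    + by apply: frame_trans fr1 _; do !apply: frame_trans (frame_update _ _ _ _).
    + move=> v vn; rewrite !updateE /=; case: (eqVneq v i) => [->|vi].
        by rewrite ltnSn pi.
      by rewrite inE // ltnS [v <= i]leq_eqVlt (negPf vi).
    + move=> x' x'n; rewrite !updateE /= outE //; case: (eqVneq x' x) => [->|x'x].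
        by rewrite /marked mxx /= ltnSn pi.
      have -> // : marked (m0 aMx) (m aPar) i.+1 x' = marked (m0 aMx) (m aPar) i x'.
      rewrite /marked (leq_eqVlt _ i.+1).
      case: (eqVneq (m0 aMx x') i.+1) => // /(mateP mt x'n i_n); rewrite xE => -[xx].
      by rewrite xx eqxx in x'x.
  step; split=> //; split=> //.
  + by apply: frame_trans fr1 _; apply: frame_update.
  + move=> v vn; rewrite updateE /= inE // ltnS [v <= i]leq_eqVlt; case: (eqVneq v i) => // ->.
    by rewrite pi ltnn.
  + move=> x' x'n; rewrite updateE /= outE //.
    have -> // : marked (m0 aMx) (m aPar) i.+1 x' = marked (m0 aMx) (m aPar) i x'.
    rewrite /marked (leq_eqVlt _ i.+1); case: (eqVneq (m0 aMx x') i.+1) => [->|] //=.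
    by rewrite pi ltnn andbF.
- move=> t m1 o1 tT m1n m1w [-> fr1 inE outE].
  have jE : m1 vJ 0 = j by unframe fr1; unframe fr; rewrite m0_j.
  have xE : m1 vX 0 = x0 by unframe fr1; unframe fr; rewrite m0_x.
  step; rewrite jE ?xE; first lia.
  set m2 := update _ _ _ _.
  have [] := bfs_fail pend bf (a' := m2 aIn) (s' := m2 aOut) fnd.
  + by move=> v vn; rewrite /m2 !updateE /= inE // vn.
  + by move=> x xn; rewrite /m2 updateE /=; case: (x == x0) => //=; exact: outE.
  move=> st' hist; split=> //; first lia.
  + by apply: frame_trans fr1 _; apply: frame_update.
  + have -> : m2 aMx = m0 aMx by rewrite -[m2 aMx]/(m1 aMx) fr1 // fr.
    by have -> : m2 aMy = m0 aMy by rewrite -[m2 aMy]/(m1 aMy) fr1 // fr.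
Qed.

Lemma search_spec o : m0 vCnt 0 = #|supp n (m0 aMx)| ->
  runs B search m0 o (fun t m' o' =>
    [/\ t <= (#|supp n (m0 aMx)|.+1) * (20 * n + 40), o' = o,
       frame search_vars m0 m',
       state n l e rank jx (j + l).+1 j.+1 n (m' aMx) (m' aMy) (m' aIn) (m' aOut) &
       [/\ same_history n j (m0 aIn) (m0 aOut) (m' aIn) (m' aOut),
          m' vCnt 0 = #|supp n (m' aMx)| & #|supp n (m' aMx)| <= #|supp n (m0 aMx)|.+1]]).
Proof.
move=> cnt; have [jn jxj x0n x0r x0f x0s _] := pend.
have supp_le : #|supp n (m0 aMx)| <= n by rewrite -[n in _ <= n]card_ord max_card.
set c := #|supp n (m0 aMx)| in cnt supp_le *.
rewrite /search; step.
apply: (@runs_for B vW _ n 1 (fun i m o' => [/\ o' = o, frame [:: aPar; vW] m0 m &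
  forall v, v < i -> m aPar v = 0])) => //; first lia.
- exact: loaded_n loaded0.
- by split=> //; apply: frame_update.
- move=> i m o1 i_n mn mw [-> fr par0].
  step; first lia.
  rewrite mw; split=> //; split=> //.
    by apply: frame_trans fr _; do !apply: frame_trans (frame_update _ _ _ _).
  move=> v; rewrite ltnS leq_eqVlt => /orP[/eqP->|vi]; rewrite !updateE /= ?eqxx //.
  by rewrite (ltn_eqF vi) par0.
move=> t0 m1 _ t0T _ _ [-> fr1 par0].
have xE : m1 vX 0 = x0 by unframe fr1; rewrite m0_x.
step; step; rewrite xE; first lia.
step; step; first lia.
step; step; first lia.
step; step; first lia.
set m2 := update _ vFnd _ _.
have fr2 : frame [:: aPar; aQueue; vHead; vTail; vFnd; vW] m0 m2.
  apply: frame_trans (frame_sub _ fr1) _ => //.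
  by do !apply: frame_trans (frame_update _ _ _ _).
have ex2 : explored 0 0 m2 by split=> //; apply: bfs_start.
step; apply: runs_weaken (explore_spec o ex2) _ => t1 m3 _ [t1T -> ex3].
have [fr3 _ _] := ex3.
have small : 3 * n + 2 + 4 + (c.+1 * (12 * n + 5) + 1) + (5 * n + 4 + c.+1 * 6 + 4) <=
  c.+1 * (20 * n + 40) by rewrite !mulSn !mulnDr; lia.
step => fnd.
- step; apply: runs_weaken (augment_spec o ex3 fnd) _ => t2 m4 _ [t2T -> fr4 st4 c4].
  have cE : m4 vCnt 0 = c by unframe fr4; unframe fr3.
  rewrite -/c in c4 t1T t2T.
  step; rewrite cE; first lia.
  split=> //; first by lia.
  + apply: frame_trans (frame_sub _ fr3) _ => //.
    apply: frame_trans (frame_sub _ fr4) _ => //; exact: frame_update.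
  + split; rewrite -?[update _ _ _ _ aIn]/(m4 aIn) -?[update _ _ _ _ aOut]/(m4 aOut).
    * by rewrite (fr4 aIn) // (fr4 aOut) // (fr3 aIn) // (fr3 aOut).
    * by rewrite -[update _ _ _ _ aMx]/(m4 aMx) c4 updateE addn1.
    * by rewrite -[update _ _ _ _ aMx]/(m4 aMx) c4.
- apply: runs_weaken (mark_spec o ex3 fnd) _ => t2 m4 _ [t2T -> fr4 st4 h4].
  have mxE : m4 aMx = m0 aMx by rewrite fr4 // fr3.
  have cE : m4 vCnt 0 = c by unframe fr4; unframe fr3.
  rewrite -/c in t1T.
  split=> //; first by lia.
  + apply: frame_trans (frame_sub _ fr3) _ => //.
    by apply: (frame_sub _ fr4).
  + by rewrite mxE cE.
Qed.

End Search.
End Specs.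

Definition release : cmd :=
  When (Minus (Var 0) (Plus (Var vJ) (Cell 0 (Const 2))))
    (vY ::= Cell aOrd (Plus (Var vJ) (Cell 0 (Const 2))) ;;
     When (Cell aMy (Var vY))
       (vX ::= Minus (Cell aMy (Var vY)) (Const 1) ;;
        Assign aMx (Var vX) (Const 0) ;;
        Assign aMy (Var vY) (Const 0) ;;
        vCnt ::= Minus (Var vCnt) (Const 1) ;;
        If (Minus (Var 0) (Cell aOut (Var vX))) Skip search)).

Definition sweep : cmd :=
  For vJ
    (If (Minus (Var vCnt) (Cell 0 (Const 1))) Skip
       (release ;; vX ::= Cell aOrd (Var vJ) ;; search)).

Section Sweep.
Variables (B n k l : nat) (e : nat -> nat -> bool) (rank ord : nat -> nat).
Hypothesis B_ge : n * n + n + 3 <= B.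
Hypothesis rank_lt : forall v, v < n -> rank v < n.
Hypothesis rank_inj : forall u v, u < n -> v < n -> rank u = rank v -> u = v.
Hypothesis ord_lt : forall p, p < n -> ord p < n.
Hypothesis ordK : forall p, p < n -> rank (ord p) = p.

Lemma same_history_trans j a s a' s' a'' s'' : same_history n j a s a' s' ->
  same_history n j a' s' a'' s'' -> same_history n j a s a'' s''.
Proof.
move=> h h' v vn; have [ha hs] := h v vn; have [ha' hs'] := h' v vn.
by split=> i ij; rewrite ?ha' ?hs' ?ha ?hs.
Qed.

Notation loaded := (loaded n k l e rank ord).
Notation state_in jx jy js exc m :=
  (state n l e rank jx jy js exc (m aMx) (m aMy) (m aIn) (m aOut)).

Lemma release_spec j m o : loaded m -> j < n -> m vJ 0 = j ->
  state_in j (j + l) j n m -> m vCnt 0 = #|supp n (m aMx)| -> m vCnt 0 <= k ->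
  runs B release m o (fun t m' o' =>
    [/\ t <= k.+1 * (20 * n + 40) + 10, o' = o, frame (vX :: search_vars) m m',
       state_in j (j + l).+1 j.+1 n m' &
       [/\ same_history n j (m aIn) (m aOut) (m' aIn) (m' aOut),
          m' vCnt 0 = #|supp n (m' aMx)| & m' vCnt 0 <= k]]).
Proof.
move=> ld jn mj st cE ck.
rewrite /release; step; rewrite (loaded_n ld) (loaded_l ld) mj; last first.
  move=> jl; step; split=> //; first lia.
  apply: state_shrink => // y yn ry.
  by have := rank_lt yn; lia.
move=> jl; have jl_n : j + l < n by lia.
have yn := ord_lt jl_n; have ry := ordK jl_n.
step; step; rewrite mj (loaded_l ld) (loaded_ord ld) //; first lia.
set y := ord (j + l) in yn ry *.
step; rewrite !updateE /=; last first.
  move=> my0; step; split=> //; [lia | exact: frame_update |].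
  apply: state_shrink => // y' y'n ry'.
  by have -> : y' = y by apply: rank_inj; rewrite ?ry.
case my_y : (m aMy y) => [//|x] _.
have xn : x < n by have := my_le (state_matching st) yn; rewrite my_y.
have mx_x : m aMx x = y.+1 by apply (mateP (state_matching st)).
have [_ rx _] := mate_arc (state_matching st) xn yn mx_x.
have [st' c'] := state_unmatch rank_inj st yn ry my_y.
step; step; rewrite !updateE /= my_y subn1 /=; first lia.
step; step; first by [].
step; step; first by [].
have cn : m vCnt 0 <= n by rewrite cE -[n in _ <= n]card_ord max_card.
step; step; rewrite ?updateE /=; first by lia.
rewrite cE c' subn1 /=.
set m1 := update _ vCnt _ _.
have fr1 : frame (vX :: search_vars) m m1.
  by do !apply: frame_trans (frame_update _ _ _ _).
have sE : m1 aOut = m aOut by [].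
have ld1 : loaded m1 by apply: loaded_frame fr1 ld.
have supp_k : #|supp n (m1 aMx)|.+1 <= k by rewrite -[m1 aMx]/(upd (m aMx) x 0) -c' -cE.
step; rewrite (loaded_n ld1) -[m1 vX 0]/x => sx.
  step; split=> //; [lia | apply: state_known st' _; rewrite sE in sx; lia |].
  by split=> //; exact: ltnW.
have s_x : m aOut x = n.
  by have := state_s st xn; rewrite sE in sx; lia.
have pend : pending n l e rank j j x (m1 aMx) (m1 aMy) (m1 aIn) (m1 aOut).
  by apply: state_pending => //; rewrite -[m1 aMx]/(upd (m aMx) x 0) updE eqxx.
apply: runs_weaken (search_spec B_ge ld1 mj erefl pend o erefl) _.
move=> t m2 _ [tT -> fr2 st2 [hist cE2 c_le]]; split=> //.
- have : #|supp n (m1 aMx)|.+1 * (20 * n + 40) <= k.+1 * (20 * n + 40).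
    by rewrite leq_mul2r ltnS ltnW ?orbT.
  move: tT; set T := _ * _; set T' := _ * _; lia.
- by apply: frame_trans fr1 (frame_sub _ fr2).
- by split=> //; rewrite cE2; exact: leq_trans c_le supp_k.
Qed.

Definition swept (j : nat) (m : memory) : Prop :=
  [/\ loaded m, m vCnt 0 = #|supp n (m aMx)| &
   ((m vCnt 0 <= k) /\ state_in j (j + l) j n m /\
      forall i, i < j -> #|[set v : 'I_n | m aIn v <= i <= m aOut v]| <= (l + 2 * k).+1) \/
   (m vCnt 0 = k.+1 /\ exists i, matching n e rank i (i + l) (m aMx) (m aMy))].

Lemma sweep_spec m o : swept 0 (update m vJ 0 0) ->
  runs B sweep m o (fun t m' o' =>
    [/\ t <= n * (2 * (k.+1 * (20 * n + 40)) + 20) + 2, o' = o & swept n m']).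
Proof.
move=> sw0; rewrite /sweep.
apply: (@runs_for B vJ _ n (2 * (k.+1 * (20 * n + 40)) + 18)
  (fun j m' o' => o' = o /\ swept j m')) => //.
- lia.
- by case: sw0 => /loaded_n.
- move=> j m1 o1 jn mn mj [-> [ld cE alt]].
  step; rewrite (loaded_k ld).
    move=> ck; step; split=> //; first lia.
    split=> //; split=> //.
      by apply: loaded_frame (frame_update m1 0 j.+1 (mem_head vJ [::])) ld.
    by right; case: alt => // -[ck' _]; lia.
  move=> ck; have {}ck : m1 vCnt 0 <= k by lia.
  case: alt => [[_ [st bags]]|[cE' _]]; last by lia.
  step; apply: runs_weaken (release_spec o ld jn mj st cE ck) _.
  move=> t1 m2 _ [t1T -> fr2 st2 [hist2 cE2 ck2]].
  have ld2 : loaded m2 by apply: loaded_frame fr2 ld.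
  have mj2 : m2 vJ 0 = j by rewrite fr2.
  have xn := ord_lt jn.
  step; step; rewrite mj2 (loaded_ord ld2) //; first lia.
  set m3 := update _ _ _ _.
  have fr3 : frame (vX :: search_vars) m2 m3 by exact: frame_update.
  have ld3 : loaded m3 by apply: loaded_frame fr3 ld2.
  have pend := state_grow rank_inj st2 jn xn (ordK jn).
  apply: runs_weaken (search_spec B_ge ld3 mj2 erefl pend o cE2) _.
  move=> t4 m4 _ [t4T -> fr4 st4 [hist4 cE4 c_le]].
  have ld4 : loaded m4 by apply: loaded_frame fr4 ld3.
  have fr42 : frame (vX :: search_vars) m2 m4 by apply: frame_trans fr3 (frame_sub _ fr4).
  have hist := same_history_trans hist2 hist4.
  rewrite -[m3 aMx]/(m2 aMx) -cE2 in t4T c_le.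
  split=> //.
  + have : (m2 vCnt 0).+1 * (20 * n + 40) <= k.+1 * (20 * n + 40).
      by rewrite leq_mul2r ltnS ck2 orbT.
    move: t1T t4T; set T := _ * _; set T' := _ * _; lia.
  + exact: loaded_n ld4.
  + by rewrite fr42.
  split=> //; split=> //.
    by apply: loaded_frame (frame_update m4 0 j.+1 (mem_head vJ [::])) ld4.
  rewrite -[update _ _ _ _ vCnt 0]/(m4 vCnt 0).
  case: (leqP (m4 vCnt 0) k) => ck4; [left|right].
    split=> //; split=> //.
    move=> i; rewrite ltnS leq_eqVlt => /orP[/eqP->|ij].
      apply: (card_bag rank_inj st _ st4); rewrite -?cE -?cE4 //.
      by move=> v vn; have [_ ->] := hist v vn.
    apply: leq_trans (bags i ij); apply: subset_leq_card; apply/subsetP=> v; rewrite !inE.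
    by have [-> // ->] := hist v (ltn_ord v); rewrite // ltnW.
  split; first by rewrite cE4 in ck4 *; apply/eqP; rewrite eqn_leq ck4 andbT (leq_trans c_le).
  by exists j.+1; apply: state_matching st4.
- by move=> t m1 o1 tT _ _ [-> sw]; split=> //; lia.
Qed.

End Sweep.

(** * Ordering the vertices by outdegree *)

Lemma sum_bool_card n (b : nat -> bool) :
  \sum_(v < n) b v = #|[set v : 'I_n | b v]|.
Proof. by rewrite -sum1dep_card [RHS]big_mkcond; apply: eq_bigr => v _; case: (b v). Qed.

Lemma sum_bool_le n (b : nat -> bool) w : w <= n -> \sum_(v < w) b v <= n.
Proof. by move=> wn; rewrite sum_bool_card; apply: leq_trans (max_card _) _; rewrite card_ord. Qed.

Section Rank.
Variables (n : nat) (deg : nat -> nat).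

Definition key (v : nat) : nat := deg v * n + v.

Definition rank (v : nat) : nat := \sum_(w < n) (key w < key v).

Lemma key_deg u v : u < n -> deg u < deg v -> key u < key v.
Proof.
move=> un uv; rewrite /key; have : (deg u).+1 * n <= deg v * n by rewrite leq_mul2r uv orbT.
rewrite mulSn; lia.
Qed.

Lemma rank_key u v : u < n -> key u < key v -> rank u < rank v.
Proof.
move=> un uv; rewrite /rank !(sum_bool_card n (fun w => key w < _)).
apply: proper_card; apply/properP; split.
  by apply/subsetP=> w; rewrite !inE => wu; apply: ltn_trans uv.
by exists (Ordinal un); rewrite !inE ?ltnn.
Qed.

Lemma rank_lt v : v < n -> rank v < n.
Proof.
move=> vn; rewrite /rank (sum_bool_card n (fun w => key w < _)).
rewrite -[X in _ < X]card_ord -cardsT; apply: proper_card; apply/properP; split.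
  exact: subsetT.
by exists (Ordinal vn); rewrite !inE ?ltnn.
Qed.

Lemma rank_inj u v : u < n -> v < n -> rank u = rank v -> u = v.
Proof.
move=> un vn uv; have kE : key u = key v.
  by case: (ltngtP (key u) (key v)) => // [/(rank_key un)|/(rank_key vn)]; rewrite uv ltnn.
have dE : deg u = deg v.
  by case: (ltngtP (deg u) (deg v)) => // [/(key_deg un)|/(key_deg vn)]; rewrite kE ltnn.
by move: kE; rewrite /key dE => /addnI.
Qed.

Lemma deg_mono u v : v < n -> rank u <= rank v -> deg u <= deg v.
Proof.
move=> vn; apply: contraTT; rewrite -!ltnNge => /(key_deg vn); exact: rank_key.
Qed.

Lemma rank_onto p : p < n -> exists2 v, v < n & rank v = p.
Proof.
move=> pn; pose f (v : 'I_n) := Ordinal (rank_lt (ltn_ord v)).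
have inj_f : injective f.
  by move=> u v [uv]; apply/ord_inj/rank_inj.
by exists (invF inj_f (Ordinal pn)) => //; have [] := f_invF inj_f (Ordinal pn).
Qed.

End Rank.

Definition rows : cmd :=
  For vI (Assign aRow (Plus (Var vI) (Const 1)) (Plus (Cell aRow (Var vI)) (Var 0))).

Definition degrees : cmd :=
  For vI (For vW (Assign aDeg (Var vI)
    (Plus (Cell aDeg (Var vI)) (Cell aAdj (Plus (Cell aRow (Var vI)) (Var vW)))))).

Definition keys : cmd :=
  For vI (Assign aKey (Var vI) (Plus (Cell aRow (Cell aDeg (Var vI))) (Var vI))).

Definition ranks : cmd :=
  For vI
    (For vW (When (Minus (Cell aKey (Var vI)) (Cell aKey (Var vW)))
      (Assign aRank (Var vI) (Plus (Cell aRank (Var vI)) (Const 1)))) ;;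
     Assign aOrd (Cell aRank (Var vI)) (Var vI)).

Section Preprocessing.
Variables (B n : nat) (e : nat -> nat -> bool).
Hypothesis B_ge : n * n + n + 3 <= B.

Let deg v := \sum_(w < n) e v w.

Let row_le u : u <= n -> u * n <= n * n.
Proof. by move=> un; rewrite leq_mul2r un orbT. Qed.

Lemma rows_spec m o : m 0 0 = n -> m aRow 0 = 0 ->
  runs B rows m o (fun t m' o' =>
    [/\ t <= n * 3 + 2, o' = o, frame [:: aRow; vI] m m' &
       forall u, u <= n -> m' aRow u = u * n]).
Proof.
move=> mn m0; rewrite /rows.
apply: (@runs_for B vI _ n 1 (fun i m' o' => [/\ o' = o, frame [:: aRow; vI] m m' &
  forall u, u <= i -> m' aRow u = u * n])) => //; first lia.
- split=> //; first exact: frame_update.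
  by move=> u; rewrite leqn0 => /eqP->.
- move=> i m1 o1 i_n m1n m1i [-> fr row].
  step; rewrite m1n m1i row // ?addn1 -mulSnr; first by have := @row_le i.+1; lia.
  split=> //; split=> //.
    by apply: frame_trans fr _; do !apply: frame_trans (frame_update _ _ _ _).
  by move=> u; rewrite leq_eqVlt => /orP[/eqP->|ui]; rewrite !updateE /= ?eqxx // (ltn_eqF ui) row.
- by move=> t m1 o1 tT _ _ [-> fr row]; split=> //; lia.
Qed.

Lemma degrees_spec m o : m 0 0 = n -> (forall u, u < n -> m aDeg u = 0) ->
  (forall u v, u < n -> v < n -> m aAdj (m aRow u + v) = e u v) ->
  runs B degrees m o (fun t m' o' =>
    [/\ t <= n * (n * 3 + 4) + 2, o' = o, frame [:: aDeg; vI; vW] m m' &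
       forall u, u < n -> m' aDeg u = deg u]).
Proof.
move=> mn m0 adj; rewrite /degrees.
apply: (@runs_for B vI _ n (n * 3 + 2) (fun i m' o' => [/\ o' = o, frame [:: aDeg; vI; vW] m m' &
  forall u, u < n -> m' aDeg u = if u < i then deg u else 0])) => //; first lia.
- by split=> //; exact: frame_update.
- move=> i m1 o1 i_n m1n m1i [-> fr dE].
  apply: (@runs_for B vW _ n 1 (fun w m' o' => [/\ o' = o, frame [:: aDeg; vI; vW] m m',
    m' vI 0 = i & forall u, u < n -> m' aDeg u =
      if u == i then \sum_(v < w) e i v else if u < i then deg u else 0])) => //; first lia.
  + split=> //; first by apply: frame_trans fr (frame_update _ _ _ _).
    move=> u un; rewrite updateE /= dE //; case: (eqVneq u i) => // ->.
    by rewrite ltnn big_ord0.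
  + move=> w m2 o2 wn m2n m2w [-> fr2 m2i dE2].
    have adjE : m2 aAdj (m2 aRow i + w) = e i w by unframe fr2; rewrite adj.
    have sE : \sum_(v < w) e i v + e i w = \sum_(v < w.+1) e i v by rewrite big_ord_recr.
    step; rewrite m2i m2w dE2 // eqxx adjE sE.
      by have := @sum_bool_le n (e i) w.+1 wn; lia.
    split=> //; split=> //.
      by apply: frame_trans fr2 _; do !apply: frame_trans (frame_update _ _ _ _).
    move=> u un; rewrite !updateE /=; case: (eqVneq u i) => // ui.
    by rewrite dE2 // (negPf ui).
  + move=> t m2 o2 tT m2n _ [-> fr2 m2i dE2]; split=> //; split=> //.
      by apply: frame_trans fr2 (frame_update _ _ _ _).
    move=> u un; rewrite updateE /= dE2 // ltnS [u <= i]leq_eqVlt.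
    by case: (eqVneq u i) => // ->.
- move=> t m1 o1 tT _ _ [-> fr dE]; split=> //; first lia.
  by move=> u un; rewrite dE // un.
Qed.

Lemma keys_spec m o : m 0 0 = n -> (forall u, u < n -> m aDeg u = deg u) ->
  (forall u, u <= n -> m aRow u = u * n) ->
  runs B keys m o (fun t m' o' =>
    [/\ t <= n * 3 + 2, o' = o, frame [:: aKey; vI] m m' &
       forall u, u < n -> m' aKey u = key n deg u]).
Proof.
move=> mn mdeg row; rewrite /keys.
apply: (@runs_for B vI _ n 1 (fun i m' o' => [/\ o' = o, frame [:: aKey; vI] m m' &
  forall u, u < i -> m' aKey u = key n deg u])) => //; first lia.
- by split=> //; exact: frame_update.
- move=> i m1 o1 i_n m1n m1i [-> fr kE].
  have deg_n : deg i <= n by exact: sum_bool_le.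
  have E : m1 aRow (m1 aDeg i) + i = key n deg i by unframe fr; rewrite mdeg // row.
  step; rewrite m1i E; first by rewrite /key; have := row_le deg_n; lia.
  split=> //; split=> //.
    by apply: frame_trans fr _; do !apply: frame_trans (frame_update _ _ _ _).
  move=> u; rewrite ltnS leq_eqVlt => /orP[/eqP->|ui]; rewrite !updateE /= ?eqxx //.
  by rewrite (ltn_eqF ui) kE.
- by move=> t m1 o1 tT _ _ [-> fr kE]; split=> //; lia.
Qed.

Lemma ranks_spec m o : m 0 0 = n -> (forall u, u < n -> m aKey u = key n deg u) ->
  (forall u, u < n -> m aRank u = 0) ->
  runs B ranks m o (fun t m' o' =>
    [/\ t <= n * (n * 4 + 5) + 2, o' = o, frame [:: aRank; aOrd; vI; vW] m m' &
       forall u, u < n -> m' aRank u = rank n deg u /\ m' aOrd (rank n deg u) = u]).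
Proof.
move=> mn mkey m0; rewrite /ranks.
pose rk := rank n deg.
apply: (@runs_for B vI _ n (n * 4 + 3) (fun i m' o' => [/\ o' = o,
  frame [:: aRank; aOrd; vI; vW] m m',
  forall u, u < n -> m' aRank u = if u < i then rk u else 0 &
  forall u, u < i -> m' aOrd (rk u) = u])) => //; first lia.
- by split=> //; exact: frame_update.
- move=> i m1 o1 i_n m1n m1i [-> fr rE oE].
  step; apply: (@runs_for B vW _ n 2 (fun w m' o' => [/\ o' = o,
    frame [:: aRank; aOrd; vI; vW] m m', m' vI 0 = i, 
    forall u, u < n -> m' aRank u =
      if u == i then \sum_(v < w) (key n deg v < key n deg i) else if u < i then rk u else 0 &
    forall u, u < i -> m' aOrd (rk u) = u])) => //; first lia.
  + split=> //; first by apply: frame_trans fr (frame_update _ _ _ _).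
    move=> u un; rewrite updateE /= rE //; case: (eqVneq u i) => // ->.
    by rewrite ltnn big_ord0.
  + move=> w m2 o2 wn m2n m2w [-> fr2 m2i rE2 oE2].
    have kE : m2 aKey i - m2 aKey w = key n deg i - key n deg w.
      by unframe fr2; rewrite !mkey.
    have sE : \sum_(v < w.+1) (key n deg v < key n deg i) =
        \sum_(v < w) (key n deg v < key n deg i) + (key n deg w < key n deg i).
      by rewrite big_ord_recr.
    have sn := @sum_bool_le n (fun v => key n deg v < key n deg i) w.+1 wn.
    rewrite sE in sn.
    step; rewrite m2i m2w kE => kk.
      step; rewrite !m2i rE2 // eqxx.
        by have lt_wi : key n deg w < key n deg i; [lia | move: sn; rewrite lt_wi; lia].
      split=> //; split=> //.
        by apply: frame_trans fr2 _; do !apply: frame_trans (frame_update _ _ _ _).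
      move=> u un; rewrite !updateE /=; case: (eqVneq u i) => [_|ui].
        by rewrite sE; have -> : key n deg w < key n deg i by lia.
      by rewrite rE2 // (negPf ui).
    step; split=> //; split=> //; first by apply: frame_trans fr2 (frame_update _ _ _ _).
    move=> u un; rewrite updateE /= rE2 // sE.
    have lt_wi : (key n deg w < key n deg i) = false by lia.
    by rewrite lt_wi addn0.
  + move=> t m2 o2 tT m2n _ [-> fr2 m2i rE2 oE2].
    step; rewrite m2i ?rE2 // ?eqxx; first lia.
    rewrite -[\sum_(v < n) _]/(rk i).
    split=> //; first lia.
    split=> //.
    * by apply: frame_trans fr2 _; do !apply: frame_trans (frame_update _ _ _ _).
    * move=> u un; rewrite !updateE /= rE2 // ltnS [u <= i]leq_eqVlt.
      by case: (eqVneq u i) => // ->.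
    * move=> u; rewrite ltnS leq_eqVlt => /orP[/eqP->|ui]; rewrite !updateE /= ?eqxx //.
      case: (eqVneq (rk u) (rk i)) => [/rank_inj|_]; last exact: oE2.
      by move=> ->; rewrite // (ltn_trans ui).
- move=> t m1 o1 tT _ _ [-> fr rE oE]; split=> //; first lia.
  by move=> u un; rewrite rE // un oE.
Qed.

End Preprocessing.

(** * The three outcomes *)

Section Outcomes.
Variables (n k l : nat) (E : rel 'I_n) (e : nat -> nat -> bool) (ord : nat -> nat).
Hypothesis eE : forall u v : 'I_n, e u v = E u v.

Let deg v := \sum_(w < n) e v w.
Let rk := rank n deg.
Hypothesis ord_lt : forall p, p < n -> ord p < n.
Hypothesis ordK : forall p, p < n -> rk (ord p) = p.

Lemma outdegE (v : 'I_n) : outdeg E v = deg v.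
Proof.
rewrite /outdeg /deg (sum_bool_card n (e v)); apply: eq_card => w.
by rewrite !inE eE.
Qed.

Lemma window_degree_tangle p : p + l + 1 < n -> deg (ord (p + l + 1)) <= deg (ord p) + k ->
  degree_tangle E (l + 2) k [set v : 'I_n | p <= rk v <= p + l + 1].
Proof.
move=> pln dle; split; last first.
  have bounds (v : 'I_n) : p <= rk v <= p + l + 1 -> deg (ord p) <= deg v <= deg (ord p) + k.
    move=> /andP[pv vp]; apply/andP; split.
      by apply: (@deg_mono n) => //; rewrite -/rk ordK //; lia.
    apply: leq_trans dle; apply: (@deg_mono n); first exact: ord_lt.
    by rewrite -/rk ordK.
  by move=> v w; rewrite !inE !outdegE => /bounds ? /bounds ?; lia.
have lt_n (i : 'I_(l + 2)) : p + i < n by have := ltn_ord i; lia.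
pose g (i : 'I_(l + 2)) : 'I_n := Ordinal (ord_lt (lt_n i)).
have gE i : rk (g i) = p + i by rewrite ordK.
have inj_g : injective g.
  by move=> i i' /(congr1 (fun v : 'I_n => rk v)); rewrite !gE => /addnI/ord_inj.
rewrite -[X in X <= _]card_ord -(card_imset _ inj_g).
apply/subset_leq_card/subsetP=> _ /imsetP[i _ ->]; rewrite inE gE.
by have := ltn_ord i; lia.
Qed.

Lemma matching_matching_tangle jx mx my :
  (forall p, p + l + 1 < n -> deg (ord p) + k < deg (ord (p + l + 1))) ->
  matching n e rk jx (jx + l) mx my -> #|supp n mx| = k.+1 ->
  matching_tangle E k.+1 k (supp n mx) (supp n my).
Proof.
move=> gap mt cX; have [mxn myn mate arc] := mt.
have cY : #|supp n my| = k.+1 by rewrite -(card_matching mt).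
pose f (v : 'I_n) : 'I_n := insubd v (mx v).-1.
have fE (v : 'I_n) : mx v != 0 -> mx v = (f v).+1.
  move=> mv; have lt_n : (mx v).-1 < n by have := mxn _ (ltn_ord v); lia.
  by rewrite -[nat_of_ord (f v)]/(val (f v)) val_insubd lt_n; lia.
have myf (v : 'I_n) : mx v != 0 -> my (f v) = v.+1.
  by move=> mv; apply (mate v (f v)) => //; exact: fE.
have rX (v : 'I_n) : mx v != 0 -> rk v < jx.
  by move=> mv; have [] := arc _ _ (ltn_ord v) (ltn_ord (f v)) (fE _ mv).
have rY (w : 'I_n) : my w != 0 -> exists2 v : 'I_n, mx v = w.+1 & jx + l <= rk w.
  move=> mw; have vn : (my w).-1 < n by have := myn _ (ltn_ord w); lia.
  have mv : mx (Ordinal vn) = w.+1 by apply (mate (Ordinal vn) w) => //=; lia.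
  by exists (Ordinal vn) => //; have [] := arc _ _ vn (ltn_ord w) mv.
have inj_f : {in supp n mx &, injective f}.
  move=> v v'; rewrite !inE => mv mv' ff; apply/ord_inj.
  by have := myf _ mv; rewrite ff (myf _ mv') => -[].
split=> //.
- rewrite -setI_eq0; apply/eqP/setP=> v; rewrite !inE; apply/negP=> /andP[/rX lt_v /rY[_ _]].
  lia.
- exists f; split=> //.
    apply/eqP; rewrite eqEcard (card_in_imset inj_f) cX cY leqnn andbT.
    by apply/subsetP=> _ /imsetP[v + ->]; rewrite !inE => /myf->.
  move=> v; rewrite inE => mv; rewrite -eE.
  by have [] := arc _ _ (ltn_ord v) (ltn_ord (f v)) (fE _ mv).
- move=> v w; rewrite !inE => /rX rv /rY[_ _ rw]; rewrite !outdegE.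
  have rwn : rk w < n by exact: rank_lt.
  have pln : rk v + l + 1 < n by lia.
  have ordv : ord (rk v) = v.
    by apply: (@rank_inj n deg); rewrite -/rk ?ordK ?ord_lt //; lia.
  have := gap _ pln; rewrite ordv => /leq_trans; apply.
  by apply: (@deg_mono n) => //; rewrite -/rk ordK //; lia.
Qed.

Lemma state_path_decomposition mx my a s :
  state n l e rk n (n + l) n n mx my a s ->
  (forall i, i < n -> #|[set v : 'I_n | a v <= i <= s v]| <= (l + 2 * k).+1) ->
  let W := mkseq (bag (fun v : 'I_n => a v) (fun v : 'I_n => s v)) n in
  path_decomposition E W /\ (width W <= (l + 2 * k)%N%:Z)%R.
Proof.
move=> st small; split.
  apply: path_decomposition_bags; first split.
  - move=> v; have := state_a st (ltn_ord v); have := state_s st (ltn_ord v); lia.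
  - by move=> u v; rewrite -eE; apply: (state_arc st).
  - move=> v; have := state_a st (ltn_ord v).
    have : rk v < n by exact: rank_lt.
    lia.
have : \max_(W <- mkseq (bag (fun v : 'I_n => a v) (fun v : 'I_n => s v)) n) #|W| <= (l + 2 * k).+1.
  apply/bigmax_leqP_seq => _ /mapP[i + ->] _; rewrite mem_iota => /small.
  by apply: leq_trans; apply/subset_leq_card/subsetP=> v; rewrite !inE.
by rewrite /width; lia.
Qed.

End Outcomes.

Lemma nth_flatten_blocks (ss : seq (seq nat)) n u v :
  all (fun s => size s == n) ss -> v < n ->
  nth 0 (flatten ss) (u * n + v) = nth 0 (nth [::] ss u) v.
Proof.
move=> ssn vn; elim: ss u ssn => [|s ss IH] u /=; first by rewrite !nth_nil.
case/andP=> /eqP sn ssn; rewrite nth_cat sn.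
case: u => [|u]; first by rewrite vn.
by rewrite mulSn -addnA ltnNge leq_addr /= addKn IH.
Qed.

Lemma input_adj n (E : rel 'I_n) k l (u v : 'I_n) : input E k l aAdj (u * n + v) = E u v.
Proof.
rewrite /= nth_flatten_blocks //; last first.
  by apply/allP=> _ /mapP[w _ ->]; rewrite size_map size_enum_ord.
by rewrite (nth_map u) ?size_enum_ord // (nth_map v) ?size_enum_ord // !nth_ord_enum.
Qed.

Lemma encode_bits n (W : {set 'I_n}) (b : nat -> bool) :
  (forall v : 'I_n, (v \in W) = b v) ->
  [seq nat_of_bool (v \in W) | v <- enum 'I_n] = [seq nat_of_bool (b v) | v <- iota 0 n].
Proof.
by move=> Wb; rewrite -val_enum_ord -map_comp; apply: eq_map => v /=; rewrite Wb.
Qed.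

Notation cK := (Cell 0 (Const 1)).
Notation cL := (Cell 0 (Const 2)).

Definition check : cmd :=
  For vI
    (When (Minus (Var 0) (Plus (Plus (Var vI) cL) (Const 1)))
       (If (Minus (Cell aDeg (Cell aOrd (Plus (Plus (Var vI) cL) (Const 1))))
                  (Plus (Cell aDeg (Cell aOrd (Var vI))) cK))
          Skip (vTangle ::= Plus (Var vI) (Const 1)))).

Definition init : cmd :=
  For vW
    (Assign aIn (Var vW) (Minus (Cell aRank (Var vW)) cL) ;;
     Assign aOut (Var vW) (Var 0)).

Definition emit_zeros (c : expr) : cmd := For vW (If c (Emit (Const 0)) (Emit (Const 1))).

Definition emit_degree_tangle : cmd :=
  Emit (Const 1) ;;
  emit_zeros (Plus (Minus (Var vTangle) (Plus (Cell aRank (Var vW)) (Const 1)))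
                   (Minus (Cell aRank (Var vW)) (Plus (Var vTangle) cL))).

Definition emit_matching_tangle : cmd :=
  Emit (Const 2) ;;
  emit_zeros (Minus (Const 1) (Cell aMx (Var vW))) ;;
  emit_zeros (Minus (Const 1) (Cell aMy (Var vW))).

Definition emit_bags : cmd :=
  Emit (Const 3) ;;
  For vJ (emit_zeros (Plus (Minus (Cell aIn (Var vW)) (Var vJ))
                           (Minus (Var vJ) (Cell aOut (Var vW))))).

Definition preprocess : cmd := rows ;; degrees ;; keys ;; ranks ;; check.

Definition program : cmd :=
  preprocess ;;
  If (Var vTangle) emit_degree_tangle
    (init ;; sweep ;;
     If (Minus (Var vCnt) cK) emit_matching_tangle emit_bags).

Section Program.
Variables (B n : nat).
Hypothesis B_ge : n * n + n + 3 <= B.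

Lemma emit_zeros_spec c (b : nat -> bool) m o : m 0 0 = n ->
  (forall m', frame [:: vW] m m' -> m' vW 0 < n -> (eval m' c == 0) = b (m' vW 0)) ->
  runs B (emit_zeros c) m o (fun t m' o' =>
    [/\ t <= n * 4 + 2, o' = o ++ [seq nat_of_bool (b v) | v <- iota 0 n] & frame [:: vW] m m']).
Proof.
move=> mn cb; rewrite /emit_zeros.
apply: (@runs_for B vW _ n 2 (fun i m' o' =>
  o' = o ++ [seq nat_of_bool (b v) | v <- iota 0 i] /\ frame [:: vW] m m')) => //; first lia.
- by split; [rewrite cats0 | exact: frame_update].
- move=> i m1 o1 i_n m1n m1w [-> fr].
  have ciE : (eval m1 c == 0) = b i by rewrite cb ?m1w.
  have fr' : frame [:: vW] m (update m1 vW 0 i.+1) by apply: frame_trans fr (frame_update _ _ _ _).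
  have outE x : rcons (o ++ [seq nat_of_bool (b v) | v <- iota 0 i]) x =
      o ++ [seq nat_of_bool (b v) | v <- iota 0 i] ++ [:: x].
    by rewrite -cats1 catA.
  rewrite -[i.+1]addn1 iotaD map_cat /= -ciE addn1.
  step=> ci; step; first lia; try lia.
    by split=> //; split=> //; rewrite outE (negPf ci).
  by split=> //; split=> //; rewrite outE ci.
- by move=> t m1 o1 tT _ _ [-> fr]; split=> //; lia.
Qed.

Variables (k l : nat).

Lemma check_spec (deg ord : nat -> nat) m o :
  m 0 0 = n -> m 0 1 = k -> m 0 2 = l -> m vTangle 0 = 0 ->
  (forall p, p < n -> ord p < n) ->
  (forall u, u < n -> m aDeg u = deg u) -> (forall p, p < n -> m aOrd p = ord p) ->
  runs B check m o (fun t m' o' =>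
    [/\ t <= n * 5 + 2, o' = o, frame [:: vI; vTangle] m m' &
       (m' vTangle 0 = 0 /\
          forall p, p + l + 1 < n -> deg (ord p) + k < deg (ord (p + l + 1))) \/
       (exists p, [/\ m' vTangle 0 = p.+1, p + l + 1 < n &
          deg (ord (p + l + 1)) <= deg (ord p) + k])]).
Proof.
move=> mn mk ml m0 ord_lt degE ordE; rewrite /check.
apply: (@runs_for B vI _ n 3 (fun i m' o' => [/\ o' = o, frame [:: vI; vTangle] m m' &
  (m' vTangle 0 = 0 /\
     forall p, p < i -> p + l + 1 < n -> deg (ord p) + k < deg (ord (p + l + 1))) \/
  (exists p, [/\ m' vTangle 0 = p.+1, p + l + 1 < n &
     deg (ord (p + l + 1)) <= deg (ord p) + k])]))
  => //; first lia.
- by split=> //; [exact: frame_update | left].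
- move=> i m1 o1 i_n m1n m1i [-> fr alt].
  have m1k : m1 0 1 = k by rewrite fr.
  have m1l : m1 0 2 = l by rewrite fr.
  have fr' m2 : frame [:: vI; vTangle] m1 m2 -> frame [:: vI; vTangle] m (update m2 vI 0 i.+1).
    by move=> fr2; apply: frame_trans (frame_trans fr fr2) (frame_update _ _ _ _).
  step; rewrite m1n m1l m1i => il; last first.
    step; split=> //; split=> //; first exact: fr'.
    case: alt => [[z H]|]; [left; split=> // p|by right].
    by rewrite ltnS leq_eqVlt => /orP[/eqP->|]; [lia | exact: H].
  have il' : i + l + 1 < n by lia.
  have m1o : m1 aOrd = m aOrd by rewrite fr.
  have m1d : m1 aDeg = m aDeg by rewrite fr.
  step; rewrite m1i m1l m1k m1o m1d !ordE // !degE ?ord_lt // => dd.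
    step; split=> //; split=> //; first exact: fr'.
    case: alt => [[z H]|]; [left; split=> // p|by right].
    by rewrite ltnS leq_eqVlt => /orP[/eqP->|]; [lia | exact: H].
  step; rewrite m1i addn1; first lia.
  split=> //; split=> //; first by apply: fr'; apply: frame_update.
  by right; exists i; split=> //; lia.
- move=> t m1 o1 tT _ _ [-> fr alt]; split=> //.
  case: alt => [[z H]|]; [left; split=> // p pl|by right].
  by apply: H => //; lia.
Qed.

Lemma init_spec (rk : nat -> nat) m o :
  m 0 0 = n -> m 0 2 = l -> (forall v, v < n -> rk v < n) ->
  (forall v, v < n -> m aRank v = rk v) ->
  runs B init m o (fun t m' o' =>
    [/\ t <= n * 4 + 2, o' = o, frame [:: vW; aIn; aOut] m m' &
       forall v, v < n -> m' aIn v = rk v - l /\ m' aOut v = n]).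
Proof.
move=> mn ml rk_lt rkE; rewrite /init.
apply: (@runs_for B vW _ n 2 (fun i m' o' => [/\ o' = o, frame [:: vW; aIn; aOut] m m' &
  forall v, v < i -> m' aIn v = rk v - l /\ m' aOut v = n])) => //; first lia.
- by split=> //; exact: frame_update.
- move=> i m1 o1 i_n m1n m1w [-> fr ioE].
  have m1l : m1 0 2 = l by rewrite fr.
  have m1r : m1 aRank i = rk i by rewrite fr // rkE.
  have rki := rk_lt _ i_n.
  step; step; rewrite m1w m1r m1l; first lia.
  step; rewrite ?updateE /= m1n ?m1w; first lia.
  split=> //; split=> //.
    by apply: frame_trans fr _; do !apply: frame_trans (frame_update _ _ _ _).
  move=> v; rewrite ltnS leq_eqVlt !updateE /=; case: (eqVneq v i) => [->|_] //=.
  exact: ioE.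
- by move=> t m1 o1 tT _ _ [-> fr ioE]; split=> //; lia.
Qed.

Lemma emit_bags_spec m o : m 0 0 = n ->
  runs B emit_bags m o (fun t m' o' => t <= n * (n * 4 + 4) + 3 /\
    o' = rcons o 3 ++ flatten
      [seq [seq nat_of_bool (m aIn v <= i <= m aOut v) | v <- iota 0 n] | i <- iota 0 n]).
Proof.
move=> mn; rewrite /emit_bags; step; step; first lia.
apply: (@runs_for B vJ _ n (n * 4 + 2) (fun j m' o' => frame [:: vW; vJ] m m' /\
  o' = rcons o 3 ++ flatten
    [seq [seq nat_of_bool (m aIn v <= i <= m aOut v) | v <- iota 0 n] | i <- iota 0 j]))
  => //; first lia.
- by split; [exact: frame_update | rewrite cats0].
- move=> j m1 o1 jn m1n m1j [fr ->].
  apply: runs_weaken (emit_zeros_spec (b := fun v => m aIn v <= j <= m aOut v) _ m1n _) _.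
    move=> m2 fr2 w_n /=.
    rewrite (fr2 vJ) // (fr2 aIn) // (fr2 aOut) // (fr aIn) // (fr aOut) // m1j.
    by rewrite addn_eq0 !subn_eq0.
  move=> t m2 _ [tT -> fr2]; split=> //.
  + by rewrite fr2.
  + by rewrite fr2.
  split.
    apply: frame_trans fr (frame_trans (frame_sub _ fr2) _) => //; exact: frame_update.
  by rewrite -[j.+1]addn1 iotaD map_cat flatten_cat /= cats0 catA.
- by move=> t m1 o1 tT _ _ [fr ->]; split=> //; lia.
Qed.

End Program.

Lemma budget_bounds k n (X := maxn 1 k * maxn 1 n ^ 2) :
  [/\ 1 <= X, n <= X, n * n <= X, k * n <= X & k * (n * n) <= X].
Proof.
have k1 := leq_maxl 1 k; have kk := leq_maxr 1 k.
have n1 := leq_maxl 1 n; have nn := leq_maxr 1 n.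
rewrite {}/X -mulnn; move: (maxn 1 k) (maxn 1 n) k1 kk n1 nn => K N k1 kk n1 nn.
have NN : N <= N * N by rewrite leq_pmulr.
have KN : N * N <= K * (N * N) by rewrite leq_pmull.
have nN : n * n <= N * N by exact: leq_mul.
split; try lia; first by apply: leq_mul => //; lia.
exact: leq_mul.
Qed.

Section Correctness.
Variables (n k l : nat) (E : rel 'I_n).

Let B := (n + k + l + 2) ^ 2.
Let budget := maxn 1 k * maxn 1 n ^ 2.

Definition arc (u v : nat) : bool := input E k l aAdj (u * n + v) != 0.

Definition arcs_from (v : nat) : nat := \sum_(w < n) arc v w.

Let rk := rank n arcs_from.

Lemma arcE (u v : 'I_n) : arc u v = E u v.
Proof. by rewrite /arc input_adj; case: (E u v). Qed.

Lemma input_arc u v : u < n -> v < n -> input E k l aAdj (u * n + v) = arc u v.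
Proof.
move=> un vn; have := input_adj E k l (Ordinal un) (Ordinal vn).
by rewrite /arc /= => ->; case: (E _ _).
Qed.

Lemma word_bound : n * n + n + 3 <= B.
Proof. by rewrite /B -mulnn; nia. Qed.

Notation preprocess_vars := [:: aRow; aDeg; aRank; aOrd; vI; vW; aKey; vTangle].

Lemma preprocess_spec :
  runs B preprocess (input E k l) [::] (fun t m o =>
    [/\ t <= 60 * budget, o = [::], frame preprocess_vars (input E k l) m,
       loaded n k l arc rk (m aOrd) m &
       (forall p, p < n -> m aOrd p < n /\ rk (m aOrd p) = p) /\
       ((m vTangle 0 = 0 /\ forall p, p + l + 1 < n ->
           arcs_from (m aOrd p) + k < arcs_from (m aOrd (p + l + 1))) \/
        (exists p, [/\ m vTangle 0 = p.+1, p + l + 1 < n &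
           arcs_from (m aOrd (p + l + 1)) <= arcs_from (m aOrd p) + k]))]).
Proof.
have B_ge := word_bound; rewrite -/B in B_ge.
have [X1 Xn Xnn _ _] := budget_bounds k n; rewrite -/budget in X1 Xn Xnn.
set m := input E k l.
have rk_lt v : v < n -> rk v < n by exact: rank_lt.
rewrite /preprocess; step.
apply: runs_weaken (rows_spec B_ge (m := m) _ erefl erefl) _ => t1 m1 _ [t1T -> fr1 row].
have adj1 u v : u < n -> v < n -> m1 aAdj (m1 aRow u + v) = arc u v.
  by move=> un vn; rewrite row ?(ltnW un) // fr1 // /m input_arc.
have z1 a i : a \notin [:: aRow; vI] -> 1 < a -> m1 a i = 0.
  by move=> aL; rewrite fr1 //; case: a aL => [|[|a]].
step; have m1n : m1 0 0 = n by rewrite fr1.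
apply: runs_weaken (degrees_spec B_ge _ m1n _ adj1) _.
  by move=> u _; exact: z1.
move=> t2 m2 _ [t2T -> fr2 degE].
have m2n : m2 0 0 = n by rewrite fr2.
have row2 u : u <= n -> m2 aRow u = u * n by move=> un; rewrite fr2 // row.
step; apply: runs_weaken (keys_spec B_ge _ m2n degE row2) _.
move=> t3 m3 _ [t3T -> fr3 keyE].
have m3n : m3 0 0 = n by rewrite fr3.
have rank0 u : u < n -> m3 aRank u = 0 by move=> _; rewrite fr3 // fr2 // z1.
step; apply: runs_weaken (ranks_spec B_ge _ m3n keyE rank0) _.
move=> t4 m4 _ [t4T -> fr4 rankE].
have ordP p : p < n -> m4 aOrd p < n /\ rk (m4 aOrd p) = p.
  by move=> pn; have [v vn <-] := rank_onto arcs_from pn; rewrite (rankE v vn).2.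
have ord_lt p : p < n -> m4 aOrd p < n by move=> /ordP[].
have fr40 : frame [:: aRow; aDeg; aRank; aOrd; vI; vW; aKey] m m4.
  apply: frame_trans (frame_trans (frame_sub _ fr1) (frame_sub _ fr2))
    (frame_trans (frame_sub _ fr3) (frame_sub _ fr4)) => //.
have m4_0 : m4 0 = m 0 by rewrite fr40.
have deg4 u : u < n -> m4 aDeg u = arcs_from u by move=> un; rewrite fr4 // fr3 // degE.
have tangle4 : m4 vTangle 0 = 0 by rewrite fr40.
apply: runs_weaken (check_spec (B := B) (n := n) (k := k) (l := l) B_ge (deg := arcs_from)
  (ord := m4 aOrd) _ _ _ _ tangle4 ord_lt deg4 _) _; rewrite ?m4_0 //.
move=> t5 m5 _ [t5T -> fr5 alt].
have m5_0 : m5 0 = m 0 by rewrite fr5.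
have m5_ord : m5 aOrd = m4 aOrd by rewrite fr5.
split; rewrite ?m5_ord //.
- by clear -t1T t2T t3T t4T t5T X1 Xn Xnn; lia.
- by apply: frame_trans (frame_sub _ fr40) (frame_sub _ fr5).
split; rewrite ?m5_0 ?m5_ord //.
- move=> u v un vn; unframe fr5; unframe fr4; unframe fr3; rewrite row2 ?(ltnW un) //.
  by unframe fr2; unframe fr1; rewrite /m input_arc //; case: (arc u v).
- by move=> v vn; rewrite fr5 // (rankE v vn).1.
Qed.

Lemma program_correct : irreflexive E -> semicomplete E -> 5 * k <= l ->
  runs B program (input E k l) [::] (fun t m out =>
    t <= 500 * budget /\
    [\/ exists X : {set 'I_n},
          [/\ out = encode 1 [:: X], degree_tangle E (l + 2) k X & (k%:Z < pw E)%R],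
        exists X Y : {set 'I_n},
          [/\ out = encode 2 [:: X; Y], matching_tangle E (k + 1) k X Y & (k%:Z < pw E)%R]
      | exists s : seq {set 'I_n},
          [/\ out = encode 3 s, path_decomposition E s & (width s <= (l + 2 * k)%N%:Z)%R]]).
Proof.
move=> irrE scE k5l.
have B_ge := word_bound; rewrite -/B in B_ge.
have [X1 Xn Xnn Xkn Xknn] := budget_bounds k n; rewrite -/budget in X1 Xn Xnn Xkn Xknn.
have rk_lt v : v < n -> rk v < n by exact: rank_lt.
rewrite /program; step; apply: runs_weaken preprocess_spec _.
move=> t5 m5 _ [t5T -> fr5 loaded5 [ordP alt]].
have ord_lt p : p < n -> m5 aOrd p < n by move=> /ordP[].
have ordK p : p < n -> rk (m5 aOrd p) = p by move=> /ordP[].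
have m5n := loaded_n loaded5; have m5l := loaded_l loaded5.
have rank5 := loaded_rank loaded5.
step=> [tangle|no_tangle].
  have [p [pE pln dle]] : exists p, [/\ m5 vTangle 0 = p.+1, p + l + 1 < n &
      arcs_from (m5 aOrd (p + l + 1)) <= arcs_from (m5 aOrd p) + k].
    by case: alt tangle => [[-> _]|].
  have dt := window_degree_tangle arcE ord_lt ordK pln dle.
  rewrite /emit_degree_tangle; step; step; first lia.
  apply: runs_weaken (emit_zeros_spec B_ge (b := fun v => p <= rk v <= p + l + 1) _ m5n _) _.
    move=> m' fr' lt_n /=.
    rewrite (fr' vTangle) // (fr' aRank) // (fr' 0) // pE rank5 // m5l /=.
    by rewrite addn_eq0 !subn_eq0; lia.
  move=> t6 m6 _ [t6T -> _]; split; first by clear -t5T t6T X1 Xn; lia.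
  apply: Or31; exists [set v : 'I_n | p <= rk v <= p + l + 1]; split=> //.
  + rewrite /encode /= cats0 (encode_bits (b := fun v => p <= rk v <= p + l + 1)) //.
    by move=> v; rewrite inE.
  + apply: pw_gt_of_models dt => fi la mod small.
    by apply: (no_degree_tangle irrE scE mod small); lia.
have {alt} gap : forall p, p + l + 1 < n ->
    arcs_from (m5 aOrd p) + k < arcs_from (m5 aOrd (p + l + 1)).
  by case: alt no_tangle => [[_ //]|[p [-> _ _]]].
step; apply: runs_weaken (init_spec B_ge _ m5n m5l rk_lt rank5) _.
move=> t6 m6 _ [t6T -> fr6 io6].
have zero6 a i : a \notin aIn :: aOut :: preprocess_vars -> 1 < a -> m6 a i = 0.
  have fr : frame (aIn :: aOut :: preprocess_vars) (input E k l) m6.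
    by apply: frame_trans (frame_sub _ fr5) (frame_sub _ fr6).
  by move=> aL; rewrite fr //; case: a aL => [|[|a]].
have loaded6 : loaded n k l arc rk (m5 aOrd) (update m6 vJ 0 0).
  have fr7 : frame [:: vW; aIn; aOut; vJ] m5 (update m6 vJ 0 0).
    by apply: frame_trans (frame_sub _ fr6) (frame_update _ _ _ _).
  exact: loaded_frame fr7 loaded5.
have swept0 : swept n k l arc rk (m5 aOrd) 0 (update m6 vJ 0 0).
  split=> //.
    have supp0 : supp n (m6 aMx) = set0 by apply/setP=> v; rewrite !inE zero6.
    by rewrite -[update _ _ _ _ aMx]/(m6 aMx) supp0 cards0 updateE /= zero6.
  left; split; first by rewrite updateE /= zero6.
  split=> //; split.
  - by split=> [x xn|x xn|x y xn yn|x y xn yn]; rewrite !updateE /= !zero6.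
  - by [].
  - move=> u v un vn _; rewrite !updateE /= (io6 u un).2 (io6 v vn).1.
    by have := rk_lt v vn; lia.
  - by move=> v vn; rewrite updateE /= (io6 v vn).1.
  - by move=> v vn; rewrite updateE /= (io6 v vn).2 leqnn ltnW ?rk_lt.
  - by move=> v vn; rewrite updateE /= (io6 v vn).2 ltnn.
  - by move=> y yn _; rewrite updateE /= (io6 y yn).1 ltnn.
step.
apply: runs_weaken (sweep_spec B_ge rk_lt (@rank_inj n arcs_from) ord_lt ordK [::] swept0) _.
move=> t7 m7 _ [t7T -> [loaded7 cE alt7]].
have {}t7T : t7 <= 300 * budget.
  by apply: leq_trans t7T _; move: X1 Xn Xnn Xkn Xknn; clear; nia.
have m7n := loaded_n loaded7.
step; rewrite (loaded_k loaded7) => ck.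
  have [cE7 [jx mt]] : m7 vCnt 0 = k.+1 /\
      exists i, matching n arc rk i (i + l) (m7 aMx) (m7 aMy).
    by case: alt7 => // -[]; lia.
  have cX : #|supp n (m7 aMx)| = k.+1 by rewrite -cE.
  have mtg := matching_matching_tangle arcE ord_lt ordK gap mt cX.
  have bit x : (1 - x == 0) = (x != 0) by case: x.
  rewrite /emit_matching_tangle; step; step; first lia.
  step; apply: runs_weaken (emit_zeros_spec B_ge (b := fun v => m7 aMx v != 0) _ m7n _) _.
    by move=> m' fr' _ /=; rewrite (fr' aMx) // bit.
  move=> t8 m8 _ [t8T -> fr8].
  have m8n : m8 0 0 = n by rewrite fr8.
  apply: runs_weaken (emit_zeros_spec B_ge (b := fun v => m7 aMy v != 0) _ m8n _) _.
    by move=> m' fr' _ /=; rewrite (fr' aMy) // (fr8 aMy) // bit.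
  move=> t9 m9 _ [t9T -> _]; split; first by clear -t5T t6T t7T t8T t9T X1 Xn; lia.
  apply: Or32; exists (supp n (m7 aMx)), (supp n (m7 aMy)); split.
  + rewrite /encode /= cats0 (encode_bits (b := fun v => m7 aMx v != 0)).
      by rewrite (encode_bits (b := fun v => m7 aMy v != 0)) // => v; rewrite inE.
    by move=> v; rewrite inE.
  + by rewrite addn1.
  + apply: pw_gt_of_models mtg => fi la mod small.
    exact: (no_matching_tangle irrE scE mod small).
case: alt7 => [[_ [st small]]|[cE7]]; last by lia.
have [pdP pdw] := state_path_decomposition arcE st small.
apply: runs_weaken (emit_bags_spec B_ge [::] m7n) _ => t8 m8 _ [t8T ->].
split; first by clear -t5T t6T t7T t8T X1 Xn Xnn; lia.
apply: Or33; eexists; split; [|exact: pdP|exact: pdw].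
rewrite /encode; congr (_ :: flatten _); rewrite -map_comp; apply: eq_map => i /=.
by rewrite (encode_bits (b := fun v => m7 aIn v <= i <= m7 aOut v)) // => v; rewrite inE.
Qed.

End Correctness.

Theorem theorem32 :
  exists (prog : cmd) (C d : nat),
  forall (n k l : nat) (E : rel 'I_n),
    irreflexive E -> semicomplete E -> 5 * k <= l ->
  exists (t : nat) (m : memory) (out : seq nat),
    [/\ exec ((n + k + l + 2) ^ d) prog (input E k l) [::] t m out,
        t <= C * (maxn 1 k * maxn 1 n ^ 2)
      & [\/ exists X : {set 'I_n},
              [/\ out = encode 1 [:: X],
                  degree_tangle E (l + 2) k X
                & (k%:Z < pw E)%R],
            exists X Y : {set 'I_n},
              [/\ out = encode 2 [:: X; Y],
                  matching_tangle E (k + 1) k X Y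
                & (k%:Z < pw E)%R]
          | exists s : seq {set 'I_n},
              [/\ out = encode 3 s,
                  path_decomposition E s
                & (width s <= (l + 2 * k)%N%:Z)%R]]].
Proof.
exists program, 500, 2 => n k l E irrE scE k5l.
have [t [m [out [ex [time post]]]]] := program_correct irrE scE k5l.
by exists t, m, out.
Qed.
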